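(* There exists $c>0$ such that for every integer $n\ge 1$, every $n$-vertex graph $G$ that is $P_5$-free has a clique or a stable set of size at least $n^c$.
   Context: All graphs are finite and simple. $P_5$ denotes the path on five vertices. A graph $G$ is $H$-free if no induced subgraph of $G$ is isomorphic to $H$. *)

(* Defs.v *)
From mathcomp Require Import all_boot.
From Stdlib Require Import Reals.
Set Implicit Arguments. Unset Strict Implicit. Unset Printing Implicit Defensive.

Definition simple_graph (T : finType) (e : rel T) : Prop :=
  symmetric e /\ irreflexive e.

Definition is_clique (T : finType) (e : rel T) (S : {set T}) : Prop :=
  forall x y, x \in S -> y \in S -> x != y -> e x y.

Definition is_stable (T : finType) (e : rel T) (S : {set T}) : Prop :=
  forall x y, x \in S -> y \in S -> x != y -> ~~ e x y.

Definition has_induced_P5 (T : finType) (e : rel T) : Prop :=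
  exists f : 'I_5 -> T, injective f /\
    forall i j : 'I_5, e (f i) (f j) = ((i.+1 == j) || (j.+1 == i)).

Definition P5_free (T : finType) (e : rel T) : Prop := ~ has_induced_P5 e.

(* Main.v *)
(* Pass to the complement [h] of the P5-free graph and prove a weighted form: for
   a fixed exponent m and all weights z >= 0, some induced cograph P satisfies
   (sum_P z)^m >= sum z^m.  In a minimal counterexample V, scale z so that the
   best cograph has value kappa V = 1, and let mu be the probability measure
   proportional to z^m; then mu U <= (kappa U)^m for all U.

   The structural input is that for a vertex v, a set F of neighbours of v and a
   non-neighbour c of v, two non-adjacent neighbours of c in F lie in a common
   proper module of F (unless c is complete to F): otherwise v, c and a mixed
   triple of F form a P5 of the complement.  So c touches only pairwise complete
   members of the partition of F into maximal modules.  If F lies in a set X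
   that is extremal for (cost * kappa)^6 / mu, where cost X is essentially the
   mass of the non-neighbours of v touching X, averaging over this partition
   (with induction applied to the quotient when the modules are negligible)
   yields a valuable cograph Q inside N(v) touching very little.

   If some vertex has both many neighbours and many non-neighbours, such a Q is
   anticomplete to a set of large mass, which contradicts minimality.  Otherwise
   half of the mass spans a sparse graph or a very dense one.  In the sparse case
   cographs Q are removed greedily together with their neighbourhoods; in the
   dense case Gyarfas' path argument produces a P5 in the complement. *)

Require Import Defs.
From mathcomp Require Import all_boot all_order all_algebra.
From mathcomp Require Import ring lra.
Set Implicit Arguments. Unset Strict Implicit. Unset Printing Implicit Defensive.
Import Order.TTheory GRing.Theory Num.Theory.
Local Open Scope ring_scope.

(** * Masses and cographs *)

Section Mass.
Variables (R : realFieldType) (T : finType) (f : T -> R).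
Hypothesis f_ge0 : forall x, 0 <= f x.

Definition mass (S : {set T}) : R := \sum_(x in S) f x.

Lemma mass_ge0 S : 0 <= mass S.
Proof. by apply: sumr_ge0 => x _. Qed.

Lemma mass0 : mass set0 = 0.
Proof. by rewrite /mass big_set0. Qed.

Lemma mass1 x : mass [set x] = f x.
Proof. by rewrite /mass big_set1. Qed.

Lemma massD (A B : {set T}) : [disjoint A & B] -> mass (A :|: B) = mass A + mass B.
Proof.
move=> dAB; rewrite /mass -bigU //=.
by apply: eq_bigl => x; rewrite in_setU.
Qed.

Lemma massID (A B : {set T}) : mass A = mass (A :&: B) + mass (A :\: B).
Proof.
rewrite -massD ?setID //.
rewrite -setI_eq0; apply/eqP/setP => x; rewrite !inE.
by case: (x \in B); rewrite ?andbF.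
Qed.

Lemma mass_sub (A B : {set T}) : A \subset B -> mass A <= mass B.
Proof.
by move=> sAB; rewrite (massID B A) (setIidPr sAB) lerDl mass_ge0.
Qed.

Lemma mass_diff (A B : {set T}) : A \subset B -> mass (B :\: A) = mass B - mass A.
Proof. by move=> sAB; rewrite (massID B A) (setIidPr sAB) addrC addKr. Qed.

Lemma mass_setU (A B : {set T}) : mass (A :|: B) <= mass A + mass B.
Proof.
rewrite (massID _ A) setUK setDUl setDv set0U lerD2l.
by apply: mass_sub; apply: subsetDl.
Qed.

Lemma mass_bigcup (I : finType) (P : {set I}) (F : I -> {set T}) :
  mass (\bigcup_(i in P) F i) <= \sum_(i in P) mass (F i).
Proof.
elim/big_rec2: _ => [|i A B _ le_AB]; first by rewrite mass0.
by apply: le_trans (mass_setU _ _) _; rewrite lerD2l.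
Qed.

Lemma mass_disjoint_bigcup (I : finType) (P : {set I}) (F : I -> {set T}) :
    (forall i j x, i \in P -> j \in P -> x \in F i -> x \in F j -> i = j) ->
  mass (\bigcup_(i in P) F i) = \sum_(i in P) mass (F i).
Proof.
move: {2}#|P| (erefl #|P|) => n; elim: n P => [|n IHn] P cP dF.
  by have/eqP := cP; rewrite cards_eq0 => /eqP->; rewrite !big_set0 mass0.
have /card_gt0P[i iP]: (0 < #|P|)%N by rewrite cP.
rewrite (big_setD1 i) // [RHS](big_setD1 i) //= massD; last first.
  rewrite -setI_eq0; apply/set0Pn => -[x /setIP[xi /bigcupP[j /setD1P[ji jP] xj]]].
  by rewrite (dF i j x) ?eqxx in ji.
rewrite IHn //; first by move: cP; rewrite (cardsD1 i) iP => -[].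
by move=> j k x /setD1P[_ jP] /setD1P[_ kP]; apply: dF.
Qed.

Lemma mass_gt0 S : 0 < mass S -> exists x, x \in S.
Proof.
move=> mS; apply/set0Pn; apply: contraTneq mS => ->.
by rewrite mass0 ltxx.
Qed.

End Mass.

(** * Cographs and the largest weight [kappa] of a cograph *)

Section Cograph.
Variables (T : finType) (h : rel T).
Implicit Types A B P Q U W : {set T}.

Definition pure A B :=
  [forall a in A, forall b in B, h a b] || [forall a in A, forall b in B, ~~ h a b].

Lemma pureP A B :
  reflect ((forall a b, a \in A -> b \in B -> h a b) \/
           (forall a b, a \in A -> b \in B -> ~~ h a b)) (pure A B).
Proof.
apply: (iffP orP) => [[] H | [] H]; [left|right|left|right].
- by move=> a b aA bB; move/forall_inP/(_ a aA)/forall_inP/(_ b bB): H.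
- by move=> a b aA bB; move/forall_inP/(_ a aA)/forall_inP/(_ b bB): H.
- by apply/forall_inP => a aA; apply/forall_inP => b bB; apply: H.
- by apply/forall_inP => a aA; apply/forall_inP => b bB; apply: H.
Qed.

Lemma pure_sub A B A' B' : A' \subset A -> B' \subset B -> pure A B -> pure A' B'.
Proof.
move=> /subsetP sA /subsetP sB /pureP[] H; apply/pureP; [left|right];
by move=> a b aA bB; apply: H; [apply: sA|apply: sB].
Qed.

(* Cographs, described by their hereditary property: every induced subgraph on
   at least two vertices is disconnected or has a disconnected complement. *)
Definition cograph P := [forall A : {set T}, (A \subset P) && (1 < #|A|)%N ==>
  [exists B : {set T}, [&& B \subset A, B != set0, B != A & pure B (A :\: B)]]].

Lemma cographP P :
  reflect (forall A, A \subset P -> (1 < #|A|)%N ->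
     exists B, [/\ B \subset A, B != set0, B != A & pure B (A :\: B)]) (cograph P).
Proof.
apply: (iffP forallP) => [H A sA cA | H A].
  by have /existsP[B /and4P[? ? ? ?]] := implyP (H A) (introT andP (conj sA cA)); exists B.
by apply/implyP => /andP[sA cA]; have [B [? ? ? ?]] := H A sA cA; apply/existsP; exists B; apply/and4P.
Qed.

Lemma cograph_sub P Q : Q \subset P -> cograph P -> cograph Q.
Proof. by move=> sQ /cographP H; apply/cographP => A sA; apply: H; apply: subset_trans sQ. Qed.

Lemma cograph_small P : (#|P| <= 1)%N -> cograph P.
Proof.
move=> cP; apply/cographP => A sA cA.
by have := leq_trans (leq_trans cA (subset_leq_card sA)) cP.
Qed.

Lemma cograph0 : cograph set0.
Proof. by apply: cograph_small; rewrite cards0. Qed.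

Lemma cograph1 x : cograph [set x].
Proof. by apply: cograph_small; rewrite cards1. Qed.

Lemma cograph_clique P : (forall x y, x \in P -> y \in P -> x != y -> h x y) -> cograph P.
Proof.
move=> clP; apply/cographP => A /subsetP sA cA.
have /card_gt0P[a aA]: (0 < #|A|)%N by apply: ltnW.
exists [set a]; split; rewrite ?sub1set //.
- by apply/set0Pn; exists a; rewrite set11.
- by apply: contraTneq cA => <-; rewrite cards1.
- apply/pureP; left=> _ b /set1P-> /setD1P[ba bA].
  by apply: clP; rewrite ?sA // eq_sym.
Qed.

Lemma cograph_pureU P Q : cograph P -> cograph Q -> [disjoint P & Q] -> pure P Q -> cograph (P :|: Q).
Proof.
move=> cP cQ dPQ pPQ; apply/cographP => A sA cA.
have [AP0|AP0] := eqVneq (A :&: P) set0.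
  move/cographP: cQ; apply=> //.
  by rewrite -(setIidPl sA) setIUr AP0 set0U subsetIr.
have [APA|APA] := eqVneq (A :&: P) A.
  by move/cographP: cP; apply=> //; rewrite -APA subsetIr.
exists (A :&: P); split => //; first by rewrite subsetIl.
apply: pure_sub pPQ; first by rewrite subsetIr.
apply/subsetP => x; rewrite !inE => /andP[+ xA].
by rewrite xA /= => xP; have := subsetP sA x xA; rewrite inE (negPf xP).
Qed.

(** Substitution preserves cographs: a set [A] meeting one part only splits inside that part;
    otherwise a pure split of the indices of the parts that [A] meets lifts to [A]. *)
Lemma cograph_blowup P (Q : T -> {set T}) :
    cograph P -> (forall q, q \in P -> cograph (Q q)) ->
    (forall q r a, q \in P -> r \in P -> a \in Q q -> a \in Q r -> q = r) ->
    (forall q r a b, q \in P -> r \in P -> q != r -> a \in Q q -> b \in Q r ->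
       h a b = h q r) ->
  cograph (\bigcup_(q in P) Q q).
Proof.
move=> cP cQ dQ hQ; apply/cographP => A sA cA.
pose PA := [set q in P | A :&: Q q != set0].
have sPA : PA \subset P by apply/subsetP => q; rewrite inE => /andP[].
have memA a : a \in A -> exists2 q, q \in PA & a \in Q q.
  move=> aA; have /bigcupP[q qP aq] := subsetP sA a aA.
  exists q => //; rewrite inE qP; apply/set0Pn; exists a; exact/setIP.
case: (ltnP 1 #|PA|) => cPA; last first.
  have /card_gt0P[a aA]: (0 < #|A|)%N by apply: ltnW.
  have [q qPA aq] := memA a aA.
  have qP := subsetP sPA q qPA.
  move/cographP: (cQ q qP); apply=> //; apply/subsetP => b bA.
  have [r rPA br] := memA b bA.
  suff -> : q = r by [].
  by apply: (card_le1_eqP cPA).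
have [B [sB B0 BA pB]] := cographP _ cP PA sPA cPA.
have sBP := subset_trans sB sPA.
have hitA q : q \in PA -> exists2 a, a \in A & a \in Q q.
  by rewrite inE => /andP[_ /set0Pn[a /setIP[]]]; exists a.
have [r /setDP[rPA rB]] : exists r, r \in PA :\: B.
  by apply/set0Pn; rewrite setD_eq0; apply: contra BA => s; rewrite eqEsubset sB.
have [q qB] : exists q, q \in B by apply/set0Pn.
exists (A :&: \bigcup_(q in B) Q q); split.
- exact: subsetIl.
- have [a aA aq] := hitA q (subsetP sB _ qB).
  by apply/set0Pn; exists a; rewrite inE aA; apply/bigcupP; exists q.
- have [a aA ar] := hitA r rPA.
  apply: contraNneq rB => /setP/(_ a); rewrite inE aA => /bigcupP[s sB' as'].
  by rewrite (dQ r s a (subsetP sPA _ rPA) (subsetP sBP _ sB') ar as').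
have hB a b : a \in A :&: \bigcup_(q in B) Q q ->
    b \in A :\: (A :&: \bigcup_(q in B) Q q) ->
    exists q' r', [/\ q' \in B, r' \in PA :\: B & h a b = h q' r'].
  move=> /setIP[aA /bigcupP[q' q'B aq']] /setDP[bA bN].
  have [r' r'PA br'] := memA b bA; exists q', r'.
  have r'B : r' \notin B.
    by apply: contra bN => r'B; rewrite inE bA; apply/bigcupP; exists r'.
  rewrite inE r'B r'PA; split=> //.
  apply: hQ => //; [exact: (subsetP sBP)|exact: (subsetP sPA)|].
  by apply: contraNneq r'B => <-.
by case/pureP: pB => H; apply/pureP; [left|right] => a b /hB/[apply] -[q' [r' [? ? ->]]]; apply: H.
Qed.

Variables (R : realFieldType) (z : T -> R).
Hypothesis z_ge0 : forall x, 0 <= z x.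

Definition best (U : {set T}) : {set T} :=
  [arg max_(P > set0 | (P \subset U) && cograph P) mass z P]%O.

Definition kappa U := mass z (best U).

Lemma bestP U : [/\ best U \subset U, cograph (best U) &
  forall P, P \subset U -> cograph P -> mass z P <= kappa U].
Proof.
rewrite /kappa /best; case: arg_maxP; first by rewrite sub0set cograph0.
by move=> P /andP[sP cP] maxP; split=> // Q sQ cQ; apply: maxP; rewrite sQ.
Qed.

Lemma best_sub U : best U \subset U. Proof. by case: (bestP U). Qed.
Lemma best_cograph U : cograph (best U). Proof. by case: (bestP U). Qed.
Lemma le_kappa U P : P \subset U -> cograph P -> mass z P <= kappa U.
Proof. by case: (bestP U) => _ _; apply. Qed.

Lemma kappa_ge0 U : 0 <= kappa U.
Proof. exact: mass_ge0. Qed.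

Lemma kappa_sub U W : U \subset W -> kappa U <= kappa W.
Proof. by move=> sU; apply: le_kappa (best_cograph _); apply: subset_trans (best_sub _) sU. Qed.

(** Optimal cographs on the two sides of a pure pair unite to a cograph. This superadditivity is
    what later conflicts with [kappa V <= 1]. *)
Lemma kappa_pure A B U : A \subset U -> B \subset U -> [disjoint A & B] -> pure A B ->
  kappa A + kappa B <= kappa U.
Proof.
move=> sA sB dAB pAB.
have dO : [disjoint best A & best B].
  exact: disjointWl (best_sub A) (disjointWr (best_sub B) dAB).
rewrite -(massD _ dO); apply: le_kappa.
  by rewrite subUset (subset_trans (best_sub _) sA) (subset_trans (best_sub _) sB).
apply: cograph_pureU => //; try exact: best_cograph.
exact: pure_sub (best_sub _) (best_sub _) pAB.
Qed.

Lemma kappa_blowup P (Q : T -> {set T}) :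
    cograph P ->
    (forall q r a, q \in P -> r \in P -> a \in Q q -> a \in Q r -> q = r) ->
    (forall q r a b, q \in P -> r \in P -> q != r -> a \in Q q -> b \in Q r ->
       h a b = h q r) ->
  exists Z : {set T}, [/\ Z \subset \bigcup_(q in P) Q q, cograph Z & mass z Z = \sum_(q in P) kappa (Q q)].
Proof.
move=> cP dQ hQ; exists (\bigcup_(q in P) best (Q q)).
have mem_best q a : a \in best (Q q) -> a \in Q q by apply: (subsetP (best_sub _)).
split.
- by apply/bigcupsP => q qP; apply: subset_trans (best_sub _) (bigcup_sup _ _).
- apply: cograph_blowup => //.
  + by move=> q _; apply: best_cograph.
  + by move=> q r a qP rP /mem_best aq /mem_best ar; apply: dQ ar.
  + by move=> q r a b qP rP qr /mem_best aq /mem_best br; apply: hQ.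
by apply: mass_disjoint_bigcup => q r a qP rP /mem_best aq /mem_best ar; apply: dQ ar.
Qed.
End Cograph.

(** * Modules in house-free graphs *)

Section Modules.
Variables (T : finType) (h : rel T).
Hypothesis h_sym : symmetric h.
Implicit Types A B D F M X : {set T}.

Definition module F D := (D \subset F) &&
  [forall x in F :\: D, forall a in D, forall b in D, h x a == h x b].

Lemma moduleP F D : reflect (D \subset F /\
   forall x a b, x \in F -> x \notin D -> a \in D -> b \in D -> h x a = h x b) (module F D).
Proof.
apply: (iffP andP) => -[sD H]; split=> //.
  move=> x a b xF xD aD bD; apply/eqP.
  have xFD : x \in F :\: D by rewrite inE xD.
  by move/forall_inP/(_ x xFD)/forall_inP/(_ a aD)/forall_inP/(_ b bD): H.
apply/forall_inP => x /setDP[xF xD]; apply/forall_inP => a aD.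
by apply/forall_inP => b bD; apply/eqP; apply: H.
Qed.

Lemma module_sub F D : module F D -> D \subset F.
Proof. by case/andP. Qed.

Lemma module_refl F : module F F.
Proof. by apply/moduleP; split=> // x a b ->. Qed.

Lemma module1 F q : q \in F -> module F [set q].
Proof. by move=> qF; apply/moduleP; rewrite sub1set; split=> // x a b _ _ /set1P-> /set1P->. Qed.

Lemma module_trans X F M : module X F -> module F M -> module X M.
Proof.
move=> /moduleP[sF HF] /moduleP[sM HM]; apply/moduleP; split.
  exact: subset_trans sM sF.
move=> x a b xX xM aM bM; case: (boolP (x \in F)) => xF; first exact: HM.
by apply: HF => //; apply: (subsetP sM).
Qed.

Lemma module_setU F A B o : o \in A -> o \in B -> module F A -> module F B -> module F (A :|: B).
Proof.
move=> oA oB /moduleP[sA HA] /moduleP[sB HB]; apply/moduleP; rewrite subUset sA; split=> //.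
move=> x a b xF; rewrite !inE negb_or => /andP[xA xB].
suff E c : (c \in A) || (c \in B) -> h x c = h x o by move=> /E-> /E->.
by case/orP => cU; [apply: HA|apply: HB].
Qed.

Lemma module_homogeneous F A B a a' b b' : module F A -> module F B ->
  [disjoint A & B] -> a \in A -> a' \in A -> b \in B -> b' \in B -> h a b = h a' b'.
Proof.
move=> /moduleP[sA HA] /moduleP[sB HB] dAB aA a'A bB b'B.
have bA : b \notin A by rewrite (disjointFl dAB bB).
have a'B : a' \notin B by rewrite (disjointFr dAB a'A).
rewrite h_sym (HA b a a' (subsetP sB b bB) bA aA a'A) h_sym.
by apply: (HB a' b b' (subsetP sA _ a'A) a'B).
Qed.

(* In the complement, v - c - x - b - a is an induced path on five vertices. *)
Definition house_free := forall v c x b a,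
  h v x -> h v b -> h v a -> h c b -> h c a -> h x a ->
  v != c -> ~~ h v c -> c != x -> ~~ h c x -> x != b -> ~~ h x b -> b != a -> ~~ h b a -> False.

Hypothesis hf : house_free.

(** [D] is the component of [q1] in the complement of [h] on the neighbours of [c] in [F]. A vertex
    of [F] outside [D] and mixed on [D] would separate some non-adjacent pair of [D]. Since [x0] is
    not in [D], the module is proper. *)
Lemma trace_module v c F q1 q2 x0 :
    v != c -> ~~ h v c -> (forall x, x \in F -> h v x) ->
    q1 \in F -> q2 \in F -> h c q1 -> h c q2 -> ~~ h q1 q2 ->
    x0 \in F -> ~~ h c x0 ->
  exists D, [/\ module F D, D != F, q1 \in D & q2 \in D].
Proof.
move=> vc hvc hvF q1F q2F cq1 cq2 q12 x0F cx0.
pose Q := [set x in F | h c x].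
pose r : rel T := [rel x y | [&& x \in Q, y \in Q, x != y & ~~ h x y]].
have rsym : symmetric r by move=> x y; rewrite /r /= h_sym eq_sym andbCA.
pose D := [set x in Q | connect r q1 x].
have q1Q : q1 \in Q by rewrite inE q1F.
have q2Q : q2 \in Q by rewrite inE q2F.
have sDF : D \subset F by apply/subsetP => x /setIdP[/setIdP[]].
exists D; split.
- apply/moduleP; split=> // x a b xF xD.
  suff E y : y \in D -> h x y = h x q1 by move=> /E-> /E->.
  (* Here [x] is not adjacent to [c], since otherwise it would join the component through [b']. So
     [v], [c], [x], [b'], [a'] contradict [house_free]. *)
  have step a' b' : r a' b' -> a' \in D -> h x a' -> ~~ h x b' -> False.
    move=> rab a'D xa xb; have /and4P[a'Q b'Q ab hab] := rab.
    have [[a'F ca'] [b'F cb']] := (setIdP a'Q, setIdP b'Q).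
    have xb' : x != b'.
      apply: contraNneq xD => ->; rewrite inE b'Q /=.
      have [_ qa'] := setIdP a'D.
      exact: connect_trans qa' (connect1 rab).
    have cx : ~~ h c x.
      apply: contra xD => cx; have xQ : x \in Q by rewrite inE xF.
      have [_ qb] := setIdP a'D.
      have qb' : connect r q1 b' by apply: connect_trans qb (connect1 rab).
      rewrite inE xQ; apply: connect_trans qb' (connect1 _).
      by rewrite /r /= b'Q xQ eq_sym xb' h_sym xb.
    have cnx : c != x by apply: contraNneq hvc => ->; apply: hvF.
    by apply: (hf (hvF x xF) (hvF b' b'F) (hvF a' a'F) cb' ca' xa vc hvc cnx cx xb' xb);
      rewrite 1?eq_sym // h_sym.
  move=> /setIdP[yQ /connectP[p + ->]].
  elim/last_ind: p => [//|p w IHp]; rewrite rcons_path last_rcons => /andP[pp rw].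
  have {}IHp := IHp pp.
  have lD : last q1 p \in D.
    have /and4P[lQ _ _ _] := rw.
    by rewrite inE lQ; apply/connectP; exists p.
  have wD : w \in D.
    have /and4P[_ wQ _ _] := rw; have [_ ql] := setIdP lD.
    by rewrite inE wQ; apply: connect_trans ql (connect1 _).
  rewrite -IHp; apply/idP/idP => hx; apply/negP => hx'; [|].
  + by apply: (step w (last q1 p)) => //; [rewrite rsym|apply/negP].
  + by apply: (step (last q1 p) w) => //; apply/negP.
- apply/eqP => DF; move: x0F; rewrite -DF => /setIdP[/setIdP[_]].
  by rewrite (negPf cx0).
- by rewrite inE q1Q /=.
- rewrite inE q2Q /=; have [->//|n12] := eqVneq q1 q2.
  by apply: connect1; rewrite /r /= q1Q q2Q n12.
Qed.
End Modules.

(** * Cographs in a neighbourhood that touch little outside it *)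

Section PowerBounds.
Variable R : realFieldType.
Implicit Types a b x w y K L : R.

(** If [2 * b <= a], divide the first bound by [a ^+ 5 >= 32 * b ^+ 5]; if [a < 2 * b], the bound
    [64 * x <= w] suffices. *)
Lemma sixth_power_tradeoff a b x w : 0 < a -> 0 <= b -> 0 <= x -> 0 <= w ->
  a ^+ 6 * x <= b ^+ 6 * w -> 64 * x <= w -> 32 * a * x <= b * w.
Proof.
move=> a0 b0 x0 w0 H1 H2; have [ab|ba] := lerP (2 * b) a; last first.
  apply: (@le_trans _ _ (a / 2 * w)).
    have : a * (64 * x) <= a * w by rewrite ler_pM2l.
    lra.
  by apply: ler_wpM2r => //; lra.
have a5 : 0 < a ^+ 5 by rewrite exprn_gt0.
rewrite -(ler_pM2l a5).
have E : a ^+ 5 * (32 * a * x) = 32 * (a ^+ 6 * x) by ring.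
rewrite E; apply: (@le_trans _ _ (32 * (b ^+ 6 * w))); first by rewrite ler_pM2l.
have : (2 * b) ^+ 5 * (b * w) <= a ^+ 5 * (b * w).
  apply: ler_wpM2r; first exact: mulr_ge0.
  by rewrite lerXn2r // nnegrE; lra.
have -> : (2 * b) ^+ 5 * (b * w) = 32 * (b ^+ 6 * w) by ring.
by [].
Qed.

Lemma small_bounds L y : 1 <= L -> 0 < y -> 5184 * L ^+ 5 * y <= 1 ->
  [/\ y <= 5184^-1, 72 * L ^+ 2 * y <= 1 & 3 * L * y <= 1].
Proof.
move=> L1 y0 H.
have L0 : 0 <= L by lra.
have hL n : (n <= 5)%N -> L ^+ n * y <= L ^+ 5 * y.
  by move=> n5; rewrite ler_pM2r // ler_weXn2l.
have := hL 0 isT; have := hL 1 isT; have := hL 2 isT.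
rewrite expr0 expr1 => h2 h1 h0.
split; lra.
Qed.
End PowerBounds.

Section Blob.
Variables (T : finType) (h : rel T).
Hypotheses (h_sym : symmetric h) (h_irr : irreflexive h) (hf : house_free h).
Variables (R : realFieldType) (z mu : T -> R) (m : nat) (V : {set T}).
Hypotheses (z_ge0 : forall x, 0 <= z x) (mu_ge0 : forall x, 0 <= mu x).
Hypothesis kV : kappa h z V <= 1.
Hypothesis muV : mass mu V <= 1.
Hypothesis mu_le : forall U : {set T}, U \subset V -> mass mu U <= kappa h z U ^+ m.
(* Minimality for arbitrary new weights: it is applied to a set of representatives
   of modules, each weighing as much as the best cograph of its module. *)
Hypothesis weighted : forall (S : {set T}) (z' : T -> R), S \proper V -> (forall x, 0 <= z' x) ->
  exists P : {set T}, [/\ P \subset S, cograph h P & \sum_(x in S) z' x ^+ m <= mass z' P ^+ m].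
Variables (v : T) (N V' : {set T}) (y L : R).
Hypotheses (vV : v \in V) (sN : N \subset V) (sV' : V' \subset V).
Hypothesis hvN : forall x, x \in N -> h v x.
Hypothesis hvV' : forall c, c \in V' -> (v != c) && ~~ h v c.
Hypotheses (y0 : 0 < y) (yN : y <= mass mu N) (L1 : 1 <= L).
Hypotheses (yL : 5184 * L ^+ 5 * y <= 1) (m_ge : (34 <= m)%N).

Definition touched (U : {set T}) := [set c in V' | [exists q in U, h c q]].
Definition complete_to (U : {set T}) := [set c in V' | [forall q in U, h c q]].

(** In the sparse case this follows from a degree bound, in the degree dichotomy from the absence of
    heavy pure pairs. *)
Hypothesis complete_le : forall U : {set T}, U \subset N -> y ^+ 12 <= mass mu U -> mass mu (complete_to U) <= y.

Local Notation M := (mass mu).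
Local Notation k := (kappa h z).
(** The summand [y] keeps the cost positive and absorbs the vertices complete to a large set, whose
    mass [complete_le] bounds. *)
Local Notation cost U := (y + M (touched U)).

Lemma touched_subset (U W : {set T}) : U \subset W -> touched U \subset touched W.
Proof.
move=> sU; apply/subsetP => c; rewrite !inE => /andP[-> /exists_inP[q qU hq]] /=.
by apply/exists_inP; exists q => //; apply: (subsetP sU).
Qed.

Lemma cost_ge (U : {set T}) : y <= cost U.
Proof. by rewrite lerDl mass_ge0. Qed.

Lemma cost_gt0 (U : {set T}) : 0 < cost U.
Proof. exact: lt_le_trans y0 (cost_ge U). Qed.

Lemma cost_sub (U W : {set T}) : U \subset W -> cost U <= cost W.
Proof. by move=> sU; rewrite lerD2l mass_sub // touched_subset. Qed.

Lemma y_small : y <= 5184^-1.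
Proof. by have [] := small_bounds L1 y0 yL. Qed.

Lemma cost_le2 (U : {set T}) : cost U <= 2.
Proof.
have : M (touched U) <= M V.
  by apply: mass_sub => //; apply: subset_trans sV'; apply/subsetP => x; rewrite inE => /andP[].
have := y_small; have := muV; lra.
Qed.

Lemma kappa_le1 (U : {set T}) : U \subset N -> k U <= 1.
Proof. by move=> sU; apply: le_trans kV; apply: kappa_sub => //; apply: subset_trans sU sN. Qed.

(** The negation of the goal, refuted in the rest of the section. *)
Hypothesis no_blob : forall Q : {set T}, Q \subset N -> cograph h Q -> mass z Q < L * cost Q.

Lemma kappa_lt_cost (U : {set T}) : U \subset N -> k U < L * cost U.
Proof.
move=> sU; apply: lt_le_trans (no_blob (subset_trans (best_sub h z U) sU) (best_cograph h z U)) _.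
by apply: ler_wpM2l; [move: L1; lra|apply: cost_sub; apply: best_sub].
Qed.

(* As cost and kappa are both monotone, a minimiser of their product relative to
   mu is critical for each of them. *)
Lemma extremal : exists X : {set T}, [/\ X \subset N, 0 < M X &
  forall X' : {set T}, X' \subset N -> (cost X * k X) ^+ 6 * M X' <= (cost X' * k X') ^+ 6 * M X].
Proof.
have MN : 0 < M N by apply: lt_le_trans yN.
have PN : (N \subset N) && (0 < M N) by rewrite subxx.
pose psi U : R := (cost U * k U) ^+ 6 / M U.
exists [arg min_(U < N | (U \subset N) && (0 < M U)) psi U]%O.
case: arg_minP => // X /andP[sX X0] minX; split=> // X' sX'.
have [X'0|X'0] := ltrP 0 (M X'); last first.
  have -> : M X' = 0 by apply/eqP; rewrite eq_le X'0 mass_ge0.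
  rewrite mulr0 mulr_ge0 ?mass_ge0 // exprn_ge0 // mulr_ge0 ?kappa_ge0 //.
  exact: ltW (cost_gt0 _).
have := minX X'; rewrite sX' X'0 /psi => /(_ isT).
by rewrite ler_pdivrMr // mulrAC ler_pdivlMr.
Qed.

Section Extremal.
Variable X : {set T}.
Hypotheses (sX : X \subset N) (X0 : 0 < M X).
Hypothesis extX :
  forall X' : {set T}, X' \subset N -> (cost X * k X) ^+ 6 * M X' <= (cost X' * k X') ^+ 6 * M X.

Lemma kappaX_gt0 : 0 < k X.
Proof.
rewrite lt_neqAle kappa_ge0 // andbT; apply/eqP => k0.
have := lt_le_trans X0 (mu_le (subset_trans sX sN)).
by rewrite -k0 expr0n; case: m m_ge => [|n] _ //=; rewrite ltxx.
Qed.

Lemma kappa_critical (X' : {set T}) : X' \subset X -> k X ^+ 6 * M X' <= k X' ^+ 6 * M X.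
Proof.
move=> sX'; have sXN := subset_trans sX' sX; have := extX sXN; rewrite !exprMn -(mulrA (cost X ^+ 6)) -(mulrA (cost X' ^+ 6)) => H.
have t6 : 0 < cost X ^+ 6 by rewrite exprn_gt0 ?cost_gt0.
rewrite -(ler_pM2l t6); apply: le_trans H _.
apply: ler_wpM2r; first by rewrite mulr_ge0 ?exprn_ge0 ?kappa_ge0 ?mass_ge0.
by rewrite lerXn2r ?nnegrE ?(ltW (cost_gt0 _)) ?cost_sub.
Qed.

(** By criticality, losing a factor 4 in mass loses at most a factor [4^(1/6) < 2] in [kappa]. *)
Lemma kappa_half (A : {set T}) : A \subset X -> M X <= 4 * M A -> k X <= 2 * k A.
Proof.
move=> sA XA; rewrite leNgt; apply/negP => lt.
have k6 : (2 * k A) ^+ 6 < k X ^+ 6.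
  by rewrite ltrXn2r // mulr_ge0 ?kappa_ge0.
have := kappa_critical sA; have : k X ^+ 6 * M X <= k X ^+ 6 * (4 * M A).
  by rewrite ler_wpM2l ?exprn_ge0 ?kappa_ge0.
have : (2 * k A) ^+ 6 * M X < k X ^+ 6 * M X by rewrite ltr_pM2r.
have -> : (2 * k A) ^+ 6 * M X = 64 * (k A ^+ 6 * M X) by ring.
have : 0 <= k A ^+ 6 * M X by rewrite mulr_ge0 ?exprn_ge0 ?kappa_ge0 ?mass_ge0.
have -> : k X ^+ 6 * (4 * M A) = 4 * (k X ^+ 6 * M A) by ring.
lra.
Qed.

(** Compare [X] with [N], where the cost is at most 2, [kappa] at most 1 and the mass at least
    [y]. *)
Lemma massX_lower_kappa : y ^+ 7 * k X ^+ 6 <= 64 * M X.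
Proof.
have := extX (subxx N); rewrite exprMn.
have tk : (cost N * k N) ^+ 6 <= 64.
  have -> : (64 : R) = 2 ^+ 6 by ring.
  rewrite lerXn2r ?nnegrE ?mulr_ge0 ?kappa_ge0 ?(ltW (cost_gt0 _)) //.
  rewrite -[2]mulr1; apply: ler_pM; rewrite ?kappa_ge0 ?(ltW (cost_gt0 _)) ?cost_le2 //.
  by apply: kappa_le1.
move=> H; have {H} : cost X ^+ 6 * k X ^+ 6 * M N <= 64 * M X.
  by apply: le_trans H _; rewrite ler_wpM2r ?mass_ge0.
apply: le_trans.
have -> : y ^+ 7 * k X ^+ 6 = y ^+ 6 * k X ^+ 6 * y by ring.
have k6 : 0 <= k X ^+ 6 by rewrite exprn_ge0 ?kappa_ge0.
have y6 : y ^+ 6 * k X ^+ 6 <= cost X ^+ 6 * k X ^+ 6.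
  by rewrite ler_wpM2r // lerXn2r ?nnegrE ?cost_ge // ltW // cost_gt0.
apply: ler_pM => //; last exact: ltW.
by rewrite mulr_ge0 // exprn_ge0 // ltW.
Qed.

(** The bound [M X <= k X ^+ 34] turns the previous lemma into [y ^+ 7 <= 64 * k X ^+ 28], which
    fails for small [y] if [k X ^+ 2 < y]. This fixes the exponent 34 in [m_ge]. *)
Lemma kappaX_sq : y <= k X ^+ 2.
Proof.
rewrite leNgt; apply/negP => ky.
have k0 := kappaX_gt0; have k1 := kappa_le1 sX; have ys := y_small; have y_gt := y0.
have Mk : M X <= k X ^+ 34.
  apply: le_trans (mu_le (subset_trans sX sN)) _.
  by apply: ler_wiXn2l => //; apply: ltW.
have H := massX_lower_kappa.
have k6 : 0 < k X ^+ 6 by rewrite exprn_gt0.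
have {H} : y ^+ 7 <= 64 * k X ^+ 28.
  rewrite -(ler_pM2r k6); apply: le_trans H _.
  by rewrite -mulrA -exprD ler_pM2l.
have -> : k X ^+ 28 = (k X ^+ 2) ^+ 14 by rewrite -exprM.
have : (k X ^+ 2) ^+ 14 <= y ^+ 14 by rewrite lerXn2r ?nnegrE ?exprn_ge0 ?ltW.
have y7 : 0 < y ^+ 7 by rewrite exprn_gt0.
have y7s : y ^+ 7 <= y by rewrite -[leRHS]expr1; apply: ler_wiXn2l => //; lra.
have -> : y ^+ 14 = y ^+ 7 * y ^+ 7 by ring.
have : y ^+ 7 * y ^+ 7 <= y ^+ 7 * 5184^-1 by rewrite ler_pM2l //; lra.
lra.
Qed.

Lemma massX_lower : y ^+ 11 <= M X.
Proof.
have H := massX_lower_kappa; have ys := y_small; have y_gt := y0.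
have : y ^+ 3 <= k X ^+ 6.
  have -> : k X ^+ 6 = (k X ^+ 2) ^+ 3 by ring.
  by apply: lerXn2r; [rewrite nnegrE ltW|rewrite nnegrE exprn_ge0 ?kappa_ge0|exact: kappaX_sq].
have y7 : 0 < y ^+ 7 by rewrite exprn_gt0.
rewrite -(ler_pM2l y7) => H3.
have y10 : 0 < y ^+ 10 by rewrite exprn_gt0.
have -> : y ^+ 11 = y ^+ 10 * y by ring.
have : y ^+ 10 * y <= y ^+ 10 * 5184^-1 by rewrite ler_pM2l.
have E : y ^+ 7 * y ^+ 3 = y ^+ 10 by ring.
rewrite E in H3; lra.
Qed.


(* F is a smallest module of X with at least half of its mass; a proper module of
   F is then pure to a quarter of the mass of X, hence has small kappa. *)
Lemma exists_core : exists F : {set T}, [/\ module h X F, M X <= 2 * M F &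
  forall D : {set T}, module h F D -> D != F -> D != set0 -> 64 * M D <= M X /\ 2 * k D <= k X].
Proof.
have PX : module h X X && (M X <= 2 * M X).
  by rewrite module_refl /=; have := X0; lra.
exists [arg min_(F < X | module h X F && (M X <= 2 * M F)%R) #|F|]%N.
case: arg_minnP => // F /andP[mF XF] minF; split=> // D mD DF /set0Pn[o oD].
have mXD := module_trans mF mD.
have sDX := module_sub mXD; have sDF := module_sub mD.
have MD : 2 * M D < M X.
  rewrite ltNge; apply/negP => MD.
  have := minF D; rewrite mXD MD => /(_ isT); apply/negP; rewrite -ltnNge.
  by apply: proper_card; rewrite properEneq DF.
(* As [D] is a module, adjacency to [o] decides adjacency to all of [D], so each [A b] is pure to
   [D]. As [D] has less than half of the mass of [X], one of them has a quarter of it. *)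
pose A b := [set x in X :\: D | h x o == b].
have AE b x d : x \in A b -> d \in D -> h x d = b.
  move=> /setIdP[/setDP[xX xD] /eqP <-] dD.
  by have /moduleP[_] := mXD; apply.
have [b Ab] : exists b, M X <= 4 * M (A b).
  have : M (X :\: D) = M (A true) + M (A false).
    rewrite (massID mu _ [set x | h x o]); congr (_ + _); congr (mass _ _).
      by apply/setP => x; rewrite !inE eqb_id.
    by apply/setP => x; rewrite !inE eqbF_neg andbC.
  rewrite mass_diff // => E.
  by have [le|lt] := lerP (M X) (4 * M (A true)); [exists true|exists false; lra].
have sAX : A b \subset X by apply/subsetP => x /setIdP[/setDP[]].
have kA := kappa_half sAX Ab.
have kDA : k D + k (A b) <= k X.
  apply: kappa_pure => //.
    rewrite -setI_eq0; apply/eqP/setP => x; rewrite !inE.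
    by case: (x \in D); rewrite ?andbF.
  by apply/pureP; case Eb: b; [left|right] => d x dD xA; rewrite h_sym (AE _ _ _ xA dD).
have kD : 2 * k D <= k X by move: kA kDA; lra.
(* Criticality converts the factor 2 in [kappa] into the factor [2 ^+ 6] in mass. *)
split=> //; have k6 : 0 < k X ^+ 6 by rewrite exprn_gt0 ?kappaX_gt0.
have H1 := kappa_critical sDX; have H2 : (2 * k D) ^+ 6 * M X <= k X ^+ 6 * M X.
  by rewrite ler_wpM2r ?mass_ge0 // lerXn2r // nnegrE ?kappa_ge0 // mulr_ge0 ?kappa_ge0.
have E : (2 * k D) ^+ 6 * M X = 64 * (k D ^+ 6 * M X) by ring.
rewrite E in H2.
suff H : k X ^+ 6 * (64 * M D) <= k X ^+ 6 * M X by move: H; rewrite ler_pM2l.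
move: H1 H2; have -> : k X ^+ 6 * (64 * M D) = 64 * (k X ^+ 6 * M D) by ring.
lra.
Qed.

Section Partition.
Variable F : {set T}.
Hypotheses (mF : module h X F) (XF : M X <= 2 * M F).
Hypothesis smallF :
  forall D : {set T}, module h F D -> D != F -> D != set0 -> 64 * M D <= M X /\ 2 * k D <= k X.

Lemma sFX : F \subset X. Proof. exact: module_sub mF. Qed.
Lemma sFN : F \subset N. Proof. exact: subset_trans sFX sX. Qed.

Lemma massF_gt0 : 0 < M F.
Proof. by have := X0; have := XF; lra. Qed.

Lemma complete_F : M (complete_to F) <= y.
Proof.
apply: complete_le; first exact: sFN.
have := massX_lower; have := XF; have ys := y_small.
have y11 : 0 < y ^+ 11 by rewrite exprn_gt0.
have -> : y ^+ 12 = y ^+ 11 * y by ring.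
have : y ^+ 11 * y <= y ^+ 11 * 5184^-1 by rewrite ler_pM2l.
lra.
Qed.

(** If [F] were a single vertex, whatever touches it would be complete to it. Its cost would be at
    most [2 * y], so [kappa] would be too small for [kappaX_sq]. *)
Lemma F_card : (1 < #|F|)%N.
Proof.
rewrite ltnNge; apply/negP => cF.
have tF : cost F <= 2 * y.
  suff : M (touched F) <= M (complete_to F) by have := complete_F; lra.
  apply: mass_sub => //; apply/subsetP => c; rewrite !inE => /andP[-> /exists_inP[q qF cq]].
  apply/forall_inP => r rF; suff -> : r = q by [].
  by apply: (card_le1_eqP cF).
have kF : k F < 2 * L * y.
  apply: lt_le_trans (kappa_lt_cost sFN) _; rewrite (mulrC 2) -mulrA ler_wpM2l //.
  by have := L1; lra.
have kXF : k X <= 2 * k F.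
  by apply: kappa_half sFX _; have := massF_gt0; have := XF; lra.
have [_ L2 _] := small_bounds L1 y0 yL.
have k2 : k X ^+ 2 < (4 * L * y) ^+ 2.
  by rewrite ltrXn2r ?kappa_ge0 //; move: kF kXF; lra.
have E : (4 * L * y) ^+ 2 = 16 * (L ^+ 2 * y) * y by ring.
rewrite E in k2.
have e : 16 * (L ^+ 2 * y) * y <= 1 * y.
  apply: ler_wpM2r; first exact: ltW.
  have : 0 <= L ^+ 2 * y by rewrite mulr_ge0 ?sqr_ge0 // ltW.
  by move: L2; rewrite -mulrA; lra.
by move: (lt_le_trans k2 e); rewrite mul1r ltNge kappaX_sq.
Qed.

(* Two proper modules that meet are too light to cover F, so their union is again
   proper and the maximal proper modules partition F. *)
Definition maxmodule (q : T) : {set T} :=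
  [arg max_(D > [set q] | [&& module h F D, D != F & q \in D]) #|D|]%N.

Lemma maxmoduleP q : q \in F -> [/\ module h F (maxmodule q), maxmodule q != F, q \in maxmodule q &
  forall D o, module h F D -> D != F -> o \in D -> o \in maxmodule q -> D \subset maxmodule q].
Proof.
move=> qF; rewrite /maxmodule; case: arg_maxnP.
  rewrite module1 // set11 andbT /=; apply: contraTneq F_card => <-.
  by rewrite cards1.
move=> A /and3P[mA AF qA] maxA; split=> // D o mD DF oD oA.
have mU : module h F (D :|: A) by apply: module_setU oD oA mD mA.
have UF : D :|: A != F.
  have [D64 _] : 64 * M D <= M X /\ 2 * k D <= k X.
    by apply: smallF => //; apply/set0Pn; exists o.
  have [A64 _] : 64 * M A <= M X /\ 2 * k A <= k X.
    by apply: smallF => //; apply/set0Pn; exists o.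
  apply/eqP => E; have := mass_setU mu_ge0 D A; rewrite E => ?.
  by have := X0; have := XF; lra.
have := maxA (D :|: A); rewrite mU UF inE qA orbT => /(_ isT) le.
have /eqP -> : A == D :|: A by rewrite eqEcard subsetUr.
exact: subsetUl.
Qed.

Lemma maxmodule_eq q r : q \in F -> r \in maxmodule q -> maxmodule r = maxmodule q.
Proof.
move=> qF rq; have [mq nq qq Hq] := maxmoduleP qF.
have rF : r \in F by apply: (subsetP (module_sub mq)).
have [mr nr rr Hr] := maxmoduleP rF.
by apply/eqP; rewrite eqEsubset (Hq _ r) ?(Hr _ r).
Qed.

(** The choice depends on the set [maxmodule q] only, so all members of a class share it; for [q] in
    [F] the default is never reached. *)
Definition rep (q : T) : T := odflt q [pick x in maxmodule q].

Lemma rep_mem q : q \in F -> rep q \in maxmodule q.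
Proof. by move=> /maxmoduleP[_ _ qq _]; rewrite /rep; case: pickP => [x //|/(_ q)]; rewrite qq. Qed.

Lemma rep_eq q r : q \in F -> r \in F -> maxmodule q = maxmodule r -> rep q = rep r.
Proof.
move=> /maxmoduleP[_ _ qq _] rF E; rewrite /rep -E.
by case: pickP => [x //|/(_ q)]; rewrite qq.
Qed.

Definition reps := rep @: F.

Lemma reps_F q : q \in reps -> q \in F.
Proof.
case/imsetP => r rF ->; have [mr _ _ _] := maxmoduleP rF.
exact: subsetP (module_sub mr) _ (rep_mem rF).
Qed.

Lemma maxmodule_rep q : q \in F -> maxmodule (rep q) = maxmodule q.
Proof. by move=> qF; apply: maxmodule_eq => //; apply: rep_mem. Qed.

Lemma reps_rep q : q \in reps -> rep q = q.
Proof.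
move=> qS; have qF := reps_F qS; case/imsetP: qS qF => r rF -> qF.
by apply: rep_eq => //; apply: maxmodule_rep.
Qed.

Lemma maxmodule_disjoint q r a : q \in reps -> r \in reps -> a \in maxmodule q -> a \in maxmodule r -> q = r.
Proof.
move=> qS rS aq ar; rewrite -(reps_rep qS) -(reps_rep rS).
apply: rep_eq; try exact: reps_F.
by rewrite -(maxmodule_eq (reps_F qS) aq) (maxmodule_eq (reps_F rS) ar).
Qed.

Lemma maxmodule_sub q : q \in reps -> maxmodule q \subset F.
Proof. by move=> /reps_F/maxmoduleP[/module_sub]. Qed.

Lemma maxmodule_homogeneous q r a b : q \in reps -> r \in reps -> q != r -> a \in maxmodule q -> b \in maxmodule r ->
  h a b = h q r.
Proof.
move=> qS rS qr aq br.
have [mq _ qq _] := maxmoduleP (reps_F qS); have [mr _ rr _] := maxmoduleP (reps_F rS).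
apply: module_homogeneous mq mr _ aq qq br rr => //.
rewrite -setI_eq0; apply/set0Pn => -[x /setIP[xq xr]].
by rewrite (maxmodule_disjoint qS rS xq xr) eqxx in qr.
Qed.

Lemma massF_partition : M F = \sum_(q in reps) M (maxmodule q).
Proof.
rewrite -mass_disjoint_bigcup; last by move=> i j x; apply: maxmodule_disjoint.
congr mass; apply/setP => x; apply/idP/bigcupP => [xF|[q qS]].
  exists (rep x); first exact: imset_f.
  by rewrite maxmodule_rep //; have [] := maxmoduleP xF.
exact: subsetP (maxmodule_sub qS) x.
Qed.

(** Vertices complete to [F] are discarded because [trace_module] needs a non-neighbour [x0] in
    [F]. *)
Definition touched_mixed (q : T) := touched (maxmodule q) :\: complete_to F.
Local Notation p q := (M (touched_mixed q)).

(* The maximal modules touched by a fixed c that is not complete to F are pairwise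
   complete, so their best cographs unite to a cograph of X. *)
Lemma sum_kappa_touched : \sum_(q in reps) k (maxmodule q) * p q <= k X * cost X.
Proof.
(* Double counting: the sum is rearranged by the touching vertex [c], and each [c] is shown to
   contribute at most [mu c * k X]. *)
have E q : q \in reps -> k (maxmodule q) * p q =
    \sum_(c in touched X :\: complete_to F) (if c \in touched (maxmodule q) then mu c * k (maxmodule q) else 0).
  move=> qS; rewrite -big_mkcondr mulrC big_distrl /=; apply: eq_bigl => c.
  rewrite !in_setD -andbA; case: (c \in complete_to F) => //=.
  rewrite andb_idl // => ct.
  exact: subsetP (touched_subset (subset_trans (maxmodule_sub qS) sFX)) _ ct.
rewrite (eq_bigr _ E) exchange_big /=.
apply: (@le_trans _ _ (\sum_(c in touched X :\: complete_to F) mu c * k X)); last first.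
  rewrite -big_distrl /= mulrC ler_wpM2l ?kappa_ge0 //.
  apply: (@le_trans _ _ (M (touched X))); first by apply: mass_sub => //; apply: subsetDl.
  by rewrite lerDr ltW.
apply: ler_sum => c /setDP[ctX cF].
rewrite -big_mkcondr -big_distrr /= ler_wpM2l //.
have cV' : c \in V' by have /setIdP[] := ctX.
have /andP[vc hvc] := hvV' cV'.
have [x0 x0F cx0] : exists2 x, x \in F & ~~ h c x.
  move: cF; rewrite inE cV' /=.
  by move=> /forall_inPn[x xF cx]; exists x.
pose Kc := [set q in reps | c \in touched (maxmodule q)].
have Kr q : q \in Kc -> q \in reps by case/setIdP.
have cK : cograph h Kc.
  apply: cograph_clique => // q r qK rK qr; have [qS rS] := (Kr q qK, Kr r rK).
  have /setIdP[_ /setIdP[_ /exists_inP[a aq ca]]] := qK.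
  have /setIdP[_ /setIdP[_ /exists_inP[b br cb]]] := rK.
  rewrite -(maxmodule_homogeneous qS rS qr aq br); apply: contraT => nab.
  have aF := subsetP (maxmodule_sub qS) _ aq; have bF := subsetP (maxmodule_sub rS) _ br.
  have hvF x : x \in F -> h v x by move=> xF; apply: hvN; apply: (subsetP sFN).
  have [D [mD DF aD bD]] := trace_module h_sym hf vc hvc hvF aF bF ca cb nab x0F cx0.
  have [_ _ _ Hq] := maxmoduleP (reps_F qS).
  have bq := subsetP (Hq D a mD DF aD aq) _ bD.
  by rewrite (maxmodule_disjoint qS rS bq br) eqxx in qr.
have dK q r a : q \in Kc -> r \in Kc -> a \in maxmodule q -> a \in maxmodule r -> q = r.
  by move=> /Kr qS /Kr rS; apply: maxmodule_disjoint.
have hK q r a b : q \in Kc -> r \in Kc -> q != r -> a \in maxmodule q -> b \in maxmodule r -> h a b = h q r.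
  by move=> /Kr qS /Kr rS; apply: maxmodule_homogeneous.
have [Z [sZ cZ mZ]] := kappa_blowup z cK dK hK.
rewrite (eq_bigl (fun q => q \in Kc)); last by move=> q; rewrite [RHS]inE.
rewrite -mZ; apply: le_kappa => //; apply: subset_trans sZ _; apply/bigcupsP => q /Kr qS.
exact: subset_trans (maxmodule_sub qS) sFX.
Qed.

Lemma cost_maxmodule q : q \in reps -> cost (maxmodule q) <= 2 * y + p q.
Proof.
move=> qS; have : M (touched (maxmodule q)) <= M (complete_to F) + p q.
  rewrite (massID mu _ (complete_to F)) lerD2r; apply: mass_sub => //; exact: subsetIr.
by have := complete_F; lra.
Qed.

(* The mass of S1 is bounded by extremality of X, that of S2 by minimality for the
   quotient by modules, and that of S3 because kappa is tiny on its modules. *)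
Let S1 := [set q in reps | y <= p q].
Let S2 := [set q in reps | (p q < y) && (4 * L * p q <= k (maxmodule q))].
Let S3 := [set q in reps | (p q < y) && (k (maxmodule q) < 4 * L * p q)].

Lemma sum_classes (f : T -> R) :
  \sum_(q in reps) f q = \sum_(q in S1) f q + \sum_(q in S2) f q + \sum_(q in S3) f q.
Proof.
rewrite (bigID (fun q => y <= p q)) /= -addrA; congr (_ + _).
  by apply: eq_bigl => q; rewrite inE.
rewrite (bigID (fun q => 4 * L * p q <= k (maxmodule q))) /=; congr (_ + _).
  by apply: eq_bigl => q; rewrite inE -ltNge -andbA.
by apply: eq_bigl => q; rewrite inE -!ltNge -andbA.
Qed.

Lemma kappa_touched_ge0 q : 0 <= k (maxmodule q) * p q.
Proof. by rewrite mulr_ge0 ?kappa_ge0 ?mass_ge0. Qed.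

Lemma maxmodule_small q : q \in reps -> 64 * M (maxmodule q) <= M X.
Proof.
move=> qS; have [mq nq qq _] := maxmoduleP (reps_F qS).
by have [] := smallF mq nq; first by apply/set0Pn; exists q.
Qed.

(** On [S1] the cost of a module is at most [3 * p q]. Extremality with [sixth_power_tradeoff]
    bounds its mass linearly by [k (maxmodule q) * p q], and [sum_kappa_touched] sums these
    terms. *)
Lemma mass_class1 : 32 * \sum_(q in S1) M (maxmodule q) <= 3 * M X.
Proof.
have tk : 0 < cost X * k X by rewrite mulr_gt0 ?cost_gt0 ?kappaX_gt0.
rewrite -(ler_pM2l tk).
have -> : cost X * k X * (3 * M X) = 3 * (k X * cost X) * M X by ring.
apply: (@le_trans _ _ (\sum_(q in S1) 3 * (k (maxmodule q) * p q) * M X)); last first.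
  rewrite -mulr_suml -mulr_sumr ler_wpM2r ?mass_ge0 // ler_wpM2l //.
  apply: le_trans sum_kappa_touched; rewrite (sum_classes (fun q => k (maxmodule q) * p q)) -addrA lerDl.
  by rewrite addr_ge0 // sumr_ge0 // => q _; apply: kappa_touched_ge0.
rewrite [32 * _]mulr_sumr [cost X * k X * _]mulr_sumr; apply: ler_sum => q /setIdP[qS yp].
have -> : cost X * k X * (32 * M (maxmodule q)) = 32 * (cost X * k X) * M (maxmodule q) by ring.
apply: sixth_power_tradeoff => //;
  [by rewrite mulr_ge0 // kappa_touched_ge0|exact: mass_ge0|exact: mass_ge0| |exact: maxmodule_small].
have sq : maxmodule q \subset N := subset_trans (maxmodule_sub qS) sFN.
apply: le_trans (extX sq) _; apply: ler_wpM2r; first exact: mass_ge0.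
apply: lerXn2r; rewrite ?nnegrE ?mulr_ge0 ?mass_ge0 ?kappa_ge0 ?(ltW (cost_gt0 _)) //.
rewrite mulrCA mulrC ler_wpM2l ?kappa_ge0 //.
by apply: le_trans (cost_maxmodule qS) _; move: yp; lra.
Qed.

(** Criticality bounds masses by sixth powers of [kappa]. Two of the six factors are summed by
    [sum_kappa_touched]; each of the other four is at most [3 * L * y], as the costs are at most
    [3 * y]. *)
Lemma mass_class3 : 8 * \sum_(q in S3) M (maxmodule q) <= M X.
Proof.
have k0 := kappaX_gt0; have L0 : 0 <= L by move: L1; lra.
pose s := \sum_(q in S3) k (maxmodule q) ^+ 2.
have s_le : s <= 8 * L * k X.
  apply: (@le_trans _ _ (4 * L * \sum_(q in S3) k (maxmodule q) * p q)).
    rewrite mulr_sumr; apply: ler_sum => q /setIdP[_ /andP[_ /ltW le]].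
    rewrite expr2.
    have -> : 4 * L * (k (maxmodule q) * p q) = k (maxmodule q) * (4 * L * p q) by ring.
    by rewrite ler_wpM2l ?kappa_ge0.
  have : \sum_(q in S3) k (maxmodule q) * p q <= k X * cost X.
    apply: le_trans sum_kappa_touched; rewrite (sum_classes (fun q => k (maxmodule q) * p q)) lerDr.
    by rewrite addr_ge0 // sumr_ge0 // => q _; apply: kappa_touched_ge0.
  move=> H; have -> : 8 * L * k X = 4 * L * (k X * 2) by ring.
  apply: ler_wpM2l; first by rewrite mulr_ge0.
  by apply: le_trans H _; rewrite ler_wpM2l ?kappa_ge0 // cost_le2.
have H6 : k X ^+ 6 * \sum_(q in S3) M (maxmodule q) <= s * (3 * L * y) ^+ 4 * M X.
  rewrite /s !mulr_suml mulr_sumr; apply: ler_sum => q /setIdP[qS /andP[py _]].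
  have sqX := subset_trans (maxmodule_sub qS) sFX.
  apply: le_trans (kappa_critical sqX) _; apply: ler_wpM2r; first exact: mass_ge0.
  have -> : k (maxmodule q) ^+ 6 = k (maxmodule q) ^+ 2 * k (maxmodule q) ^+ 4 by ring.
  apply: ler_wpM2l; first by rewrite exprn_ge0 ?kappa_ge0.
  apply: lerXn2r; rewrite ?nnegrE ?kappa_ge0 //; first by rewrite !mulr_ge0 // ltW.
  have := kappa_lt_cost (subset_trans sqX sX) => /ltW /le_trans; apply.
  have -> : 3 * L * y = L * (3 * y) by ring.
  apply: ler_wpM2l => //; apply: le_trans (cost_maxmodule qS) _; move: py; lra.
have y3 : y ^+ 3 <= k X ^+ 5.
  apply: (@le_trans _ _ (k X ^+ 6)); last by apply: ler_wiXn2l; rewrite ?kappa_le1 // ltW.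
  have -> : k X ^+ 6 = (k X ^+ 2) ^+ 3 by ring.
  by apply: lerXn2r; [rewrite nnegrE ltW|rewrite nnegrE exprn_ge0 ?kappa_ge0|exact: kappaX_sq].
have S0 : 0 <= \sum_(q in S3) M (maxmodule q) by apply: sumr_ge0 => q _; apply: mass_ge0.
have c0 : 0 < y ^+ 3 * k X by rewrite mulr_gt0 // exprn_gt0.
rewrite -(ler_pM2l c0).
apply: (@le_trans _ _ (8 * (k X ^+ 6 * \sum_(q in S3) M (maxmodule q)))).
  have -> : 8 * (k X ^+ 6 * \sum_(q in S3) M (maxmodule q)) =
            k X ^+ 5 * (k X * (8 * \sum_(q in S3) M (maxmodule q))) by ring.
  by rewrite -mulrA ler_wpM2r // mulr_ge0 ?kappa_ge0 // mulr_ge0.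
apply: (@le_trans _ _ (8 * (8 * L * k X * (3 * L * y) ^+ 4 * M X))).
  rewrite ler_wpM2l //; apply: le_trans H6 _.
  rewrite ler_wpM2r ?mass_ge0 // ler_wpM2r // exprn_ge0 // !mulr_ge0 // ltW //.
(* The constant 5184 is [8 * 8 * 3 ^+ 4]. *)
have -> : 8 * (8 * L * k X * (3 * L * y) ^+ 4 * M X) =
          (5184 * L ^+ 5 * y) * (y ^+ 3 * k X * M X) by ring.
by rewrite ler_piMl // mulr_ge0 ?mass_ge0 // ltW.
Qed.

(** Minimality on the representatives, weighted by [kappa] of their modules, gives a cograph [P] of
    the quotient, which blows up to [Z]. On [S2] touching is cheap relative to [kappa], so [no_blob]
    forces [mass z Z <= 3 * L * y], whose [m]-th power is negligible. *)
Lemma mass_class2 : 8 * \sum_(q in S2) M (maxmodule q) <= M X.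
Proof.
have L0 : 0 <= L by move: L1; lra.
have S2r q : q \in S2 -> q \in reps by case/setIdP.
have prS2 : S2 \proper V.
  apply/properP; split; last first.
    exists v => //; apply/negP => /S2r/reps_F vF.
    by have := hvN (subsetP sFN _ vF); rewrite h_irr.
  apply/subsetP => q /S2r/reps_F qF; apply: (subsetP sN); exact: subsetP sFN _ qF.
have [P [sP cP HP]] := weighted prS2 (fun q => kappa_ge0 h z_ge0 (maxmodule q)).
have Pr q : q \in P -> q \in reps by move=> qP; apply: S2r; apply: (subsetP sP).
have dP q r a : q \in P -> r \in P -> a \in maxmodule q -> a \in maxmodule r -> q = r.
  by move=> /Pr qS /Pr rS; apply: maxmodule_disjoint.
have hP q r a b : q \in P -> r \in P -> q != r -> a \in maxmodule q -> b \in maxmodule r -> h a b = h q r.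
  by move=> /Pr qS /Pr rS; apply: maxmodule_homogeneous.
have [Z [sZ cZ mZ]] := kappa_blowup z cP dP hP.
have sZF : Z \subset F.
  by apply: subset_trans sZ _; apply/bigcupsP => q /Pr; apply: maxmodule_sub.
have tZ : 4 * L * M (touched Z) <= 4 * L * y + mass z Z.
  have : M (touched Z) <= M (complete_to F) + \sum_(q in P) p q.
    apply: le_trans (_ : _ <= M (complete_to F :|: \bigcup_(q in P) touched_mixed q)) _.
      apply: mass_sub => //; apply/subsetP => c; rewrite !inE => /andP[cV' /exists_inP[x xZ cx]].
      rewrite cV' /=; case: (boolP [forall q in F, h c q]) => //= ncF.
      have /bigcupP[q qP xq] := subsetP sZ _ xZ.
      apply/bigcupP; exists q => //; rewrite !inE cV' /= (negPf ncF) /=.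
      by apply/exists_inP; exists x.
    by apply: le_trans (mass_setU _ _ _) _ => //; rewrite lerD2l mass_bigcup.
  have : 4 * L * \sum_(q in P) p q <= mass z Z.
    rewrite mZ mulr_sumr; apply: ler_sum => q qP.
    by have := subsetP sP _ qP => /setIdP[_ /andP[_]].
  have : 4 * L * M (complete_to F) <= 4 * L * y by rewrite ler_wpM2l ?complete_F ?mulr_ge0.
  move=> H1 H2 H3; apply: le_trans (ler_wpM2l _ H3) _; first by rewrite mulr_ge0.
  by rewrite mulrDr lerD.
have zZ : mass z Z <= 3 * L * y.
  have := no_blob (subset_trans sZF sFN) cZ; rewrite mulrDr.
  have : 0 <= L * y by rewrite mulr_ge0 // ltW.
  move: tZ; rewrite -!mulrA; lra.
have SM : \sum_(q in S2) M (maxmodule q) <= mass z Z ^+ m.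
  rewrite mZ; apply: le_trans HP; apply: ler_sum => q /S2r qS; apply: mu_le.
  exact: subset_trans (maxmodule_sub qS) (subset_trans sFN sN).
have [ys L2 L3] := small_bounds L1 y0 yL.
have y_0 := y0.
(* Since [(3 * L * y) ^+ 2 <= y / 8], eleven squares give [y ^+ 11], to match [massX_lower], and a
   twelfth gives the factor [1/8]. *)
have Z24 : mass z Z ^+ m <= (3 * L * y) ^+ 24.
  apply: (@le_trans _ _ ((3 * L * y) ^+ m)).
    by apply: lerXn2r; rewrite ?nnegrE ?mass_ge0 // !mulr_ge0 // ltW.
  apply: ler_wiXn2l => //; first by rewrite !mulr_ge0 // ltW.
  exact: leq_trans m_ge.
have Ly : (3 * L * y) ^+ 2 <= y * 8^-1.
  have -> : (3 * L * y) ^+ 2 = y * (9 * L ^+ 2 * y) by ring.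
  by apply: ler_wpM2l; [exact: ltW|move: L2; lra].
have y12 : (3 * L * y) ^+ 24 <= y ^+ 11 * 8^-1.
  have -> : (3 * L * y) ^+ 24 = ((3 * L * y) ^+ 2) ^+ 11 * (3 * L * y) ^+ 2 by ring.
  apply: ler_pM; rewrite ?exprn_ge0 ?mulr_ge0 ?(ltW y0) //.
    apply: lerXn2r; rewrite ?nnegrE ?exprn_ge0 ?mulr_ge0 ?(ltW y0) //.
    by apply: le_trans Ly _; move: y_0; lra.
  by apply: le_trans Ly _; rewrite ler_piMl //; move: ys; lra.
have := massX_lower; have := le_trans SM (le_trans Z24 y12); lra.
Qed.

(** The classes carry at most [3/32 + 1/8 + 1/8 < 1/2] of the mass of [X], but [F] carries at least
    half. *)
Lemma partition_absurd : False.
Proof.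
have := massF_partition; rewrite (sum_classes (fun q => M (maxmodule q))).
have := mass_class1; have := mass_class2; have := mass_class3.
by have := XF; have := X0; lra.
Qed.
End Partition.
End Extremal.

Lemma blob_absurd : False.
Proof.
have [X [sX X0 extX]] := extremal.
have [F [mF XF smallF]] := exists_core sX X0 extX.
exact: (partition_absurd sX X0 extX mF XF smallF).
Qed.
End Blob.

(** * Minimal counterexamples *)

Section Connected.
Variables (T : finType) (h : rel T).
Hypothesis h_sym : symmetric h.
Implicit Types (A C S : {set T}).

Definition nonadj_in S : rel T := [rel x y | [&& x \in S, y \in S, x != y & ~~ h x y]].
Definition coconnected S := forall x y, x \in S -> y \in S -> connect (nonadj_in S) x y.

Lemma nonadj_in_sym S : symmetric (nonadj_in S).
Proof. by move=> x y; rewrite /nonadj_in /= h_sym eq_sym andbCA. Qed.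

Lemma coconnect_closed S A x y : (forall a b, a \in A -> b \in S :\: A -> h a b) ->
  x \in A -> connect (nonadj_in S) x y -> y \in A.
Proof.
move=> clA xA /connectP[p + ->]; elim/last_ind: p => [//|p w IH].
rewrite rcons_path last_rcons => /andP[pp /and4P[_ wS _ nh]].
have lA := IH pp; apply: contraT => wA.
by rewrite (clA _ w lA) // inE wA in nh.
Qed.

Lemma coconnect_mono S A x y : A \subset S -> connect (nonadj_in A) x y -> connect (nonadj_in S) x y.
Proof.
move=> /subsetP sA; apply: connect_sub => a b /and4P[aA bA ab nh].
by apply: connect1; rewrite /nonadj_in /= !sA // ab.
Qed.

Lemma component_coconnected S s : s \in S -> coconnected [set x in S | connect (nonadj_in S) s x].
Proof.
move=> sS; set C := [set x in S | _].
have E x : x \in C -> connect (nonadj_in C) s x.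
  move=> /setIdP[_ /connectP[p + ->]]; elim/last_ind: p => [//|p w IH].
  rewrite rcons_path last_rcons => /andP[pp rw]; apply: connect_trans (IH pp) (connect1 _).
  have /and4P[lS wS lw nh] := rw.
  have cl : connect (nonadj_in S) s (last s p) by apply/connectP; exists p.
  rewrite /nonadj_in /= !inE lS wS lw nh cl /= andbT.
  exact: connect_trans cl (connect1 rw).
move=> x y /E xC /E yC; apply: connect_trans yC.
by rewrite (sym_connect_sym (nonadj_in_sym C)).
Qed.

Lemma component_closed S s a b : a \in [set x in S | connect (nonadj_in S) s x] ->
  b \in S :\: [set x in S | connect (nonadj_in S) s x] -> h a b.
Proof.
move=> /setIdP[aS ca] /setDP[bS]; rewrite inE bS /=; apply: contraNT => nh.
have [<-//|ab] := eqVneq a b.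
by apply: connect_trans ca (connect1 _); rewrite /nonadj_in /= aS bS ab.
Qed.

Lemma coconnected_setU1 C u w : coconnected C -> w \in C -> u != w -> ~~ h u w -> coconnected (u |: C).
Proof.
move=> cC wC uw nh.
have E x : x \in u |: C -> connect (nonadj_in (u |: C)) w x.
  rewrite in_setU1 => /orP[/eqP->|xC].
    by apply: connect1; rewrite nonadj_in_sym /nonadj_in /= !inE eqxx wC uw nh orbT.
  by apply: coconnect_mono (cC w x wC xC); apply: subsetUr.
move=> x y /E xC /E yC; apply: connect_trans yC.
by rewrite (sym_connect_sym (nonadj_in_sym _)).
Qed.
End Connected.

(** * Consequences of minimality *)

Section Counterexample.
Variables (T : finType) (h : rel T).
Hypotheses (h_sym : symmetric h) (h_irr : irreflexive h) (hf : house_free h).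
Variables (R : realFieldType) (z mu : T -> R) (m : nat) (V : {set T}).
Hypotheses (z_ge0 : forall x, 0 <= z x) (mu_ge0 : forall x, 0 <= mu x).
Hypothesis kV : kappa h z V <= 1.
Hypothesis muV : mass mu V = 1.
Hypothesis mu_lt1 : forall x, x \in V -> mu x < 1.
Hypothesis mu_le : forall U : {set T}, U \subset V -> mass mu U <= kappa h z U ^+ m.
Hypothesis weighted : forall (S : {set T}) (z' : T -> R), S \proper V -> (forall x, 0 <= z' x) ->
  exists P : {set T}, [/\ P \subset S, cograph h P & \sum_(x in S) z' x ^+ m <= mass z' P ^+ m].
Hypothesis m_ge : (34 <= m)%N.

Local Notation M := (mass mu).
Local Notation k := (kappa h z).

Lemma blob (v : T) (N V' : {set T}) (y L : R) :
    v \in V -> N \subset V -> V' \subset V -> (forall x, x \in N -> h v x) ->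
    (forall c, c \in V' -> (v != c) && ~~ h v c) ->
    0 < y -> y <= M N -> 1 <= L -> 5184 * L ^+ 5 * y <= 1 ->
    (forall U : {set T}, U \subset N -> y ^+ 12 <= M U -> M (complete_to h V' U) <= y) ->
  exists Q : {set T}, [/\ Q \subset N, cograph h Q & L * (y + M (touched h V' Q)) <= mass z Q].
Proof.
move=> vV sN sV' hN hV' y0 yN L1 yL cl.
pose ok (Q : {set T}) := [&& Q \subset N, cograph h Q & L * (y + M (touched h V' Q)) <= mass z Q].
case: (boolP [exists Q : {set T}, ok Q]) => [/existsP[Q /and3P[? ? ?]]|]; first by exists Q.
rewrite negb_exists => /forallP nQ; exfalso.
apply: (blob_absurd h_sym h_irr hf z_ge0 mu_ge0 kV _ mu_le weighted vV sN sV' hN hV' y0 yN L1 yL m_ge cl).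
  by rewrite muV.
by move=> Q sQ cQ; rewrite ltNge; apply/negP => le; have := nQ Q; rewrite /ok sQ cQ le.
Qed.

(** Both sides would have [kappa] above [1/2], and these values add up. *)
Lemma pure_absurd (A B : {set T}) : A \subset V -> B \subset V -> [disjoint A & B] ->
  pure h A B -> (1 / 2) ^+ m < M A -> (1 / 2) ^+ m < M B -> False.
Proof.
move=> sA sB dAB pAB.
have half (U : {set T}) : U \subset V -> (1 / 2) ^+ m < M U -> 1 / 2 < k U.
  move=> sU lt; rewrite ltNge; apply/negP => le.
  have := lt_le_trans lt (mu_le sU); apply/negP; rewrite -leNgt.
  by apply: lerXn2r; rewrite ?nnegrE ?kappa_ge0 //; lra.
move=> /(half _ sA) kA /(half _ sB) kB.
have : k A + k B <= k V by apply: kappa_pure.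
by have := kV; lra.
Qed.

Lemma kappa1 x : k [set x] = z x.
Proof.
apply/eqP; rewrite eq_le; apply/andP; split.
  rewrite -(mass1 z x); apply: mass_sub => //; exact: best_sub.
by rewrite -(mass1 z x); apply: le_kappa => //; apply: cograph1.
Qed.

Lemma pow_decay (x : R) : 0 <= x -> x <= 1 / 2 -> 8 * x ^+ m <= x.
Proof.
move=> x0 x1; have x4 : x ^+ m <= x ^+ 4.
  by apply: ler_wiXn2l => //; [lra|exact: leq_trans m_ge].
have : x ^+ 3 <= (1 / 2) ^+ 3 by apply: lerXn2r => //; rewrite nnegrE; lra.
move=> x3; have : x * x ^+ 3 <= x * (1 / 2) ^+ 3 by rewrite ler_wpM2l.
have -> : x * x ^+ 3 = x ^+ 4 by ring.
have -> : x * (1 / 2) ^+ 3 = x / 8 by field.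
lra.
Qed.

(** Some [A b] has half of the mass [1 - mu x] outside [x] and is pure to [x]. If [z x > 1 / 2],
    then [k (A b) <= 1 - z x] is below [1 / 2] and its [m]-th power cannot account for that mass. *)
Lemma atom x : x \in V -> z x <= 1 / 2.
Proof.
move=> xV; rewrite leNgt; apply/negP => zx.
pose A b := [set u in V :\ x | h x u == b].
have [b Ab] : exists b, 1 - mu x <= 2 * M (A b).
  have : M (V :\ x) = M (A true) + M (A false).
    rewrite (massID mu _ [set u | h x u]); congr (_ + _); congr (mass _ _).
      by apply/setP => u; rewrite !inE eqb_id.
    by apply/setP => u; rewrite !inE eqbF_neg andbC.
  rewrite mass_diff ?sub1set // mass1 muV => E.
  by have [le|lt] := lerP (1 - mu x) (2 * M (A true)); [exists true|exists false; lra].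
have sA : A b \subset V by apply/subsetP => u /setIdP[/setD1P[]].
have sx : [set x] \subset V by rewrite sub1set.
have kA : z x + k (A b) <= 1.
  rewrite -kappa1; apply: le_trans kV; apply: kappa_pure => //.
    by rewrite disjoints1 !inE eqxx.
  by apply/pureP; case: (b); [left|right] => u w /set1P-> /setIdP[_ /eqP->].
have zx1 : z x <= 1 by have := kappa_ge0 h z_ge0 (A b); move: kA; lra.
have mux : mu x <= z x.
  have := mu_le sx; rewrite mass1 kappa1 => /le_trans; apply.
  rewrite -[leRHS]expr1; apply: ler_wiXn2l => //; exact: leq_trans m_ge.
have kA0 := kappa_ge0 h z_ge0 (A b).
have := pow_decay kA0; have := mu_le sA; have := mu_lt1 xV.
move=> H1 H2 H3; have {}H3 := H3 _.
have k2 : k (A b) <= 1 / 2 by move: kA; lra.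
by have := H3 k2; move: kA; lra.
Qed.

Lemma mu_atom x : x \in V -> 8 * mu x <= z x.
Proof.
move=> xV; apply: le_trans (pow_decay (z_ge0 x) (atom xV)).
rewrite ler_wpM2l // -(mass1 mu) -[in leRHS]kappa1; apply: mu_le.
by rewrite sub1set.
Qed.

Lemma mu_atom_half x : x \in V -> mu x <= (1 / 2) ^+ m.
Proof.
move=> xV; have sx : [set x] \subset V by rewrite sub1set.
rewrite -(mass1 mu); apply: le_trans (mu_le sx) _; rewrite kappa1.
by apply: lerXn2r; rewrite ?nnegrE ?atom //; lra.
Qed.

(** * The sparse case *)

Section Sparse.
Variables (Y : {set T}) (eps : R).
Hypotheses (sY : Y \subset V) (eps_small : 5184 * 6 ^+ 5 * eps <= 1).
Hypothesis degY : forall x, x \in Y -> M [set u in Y | h x u] <= eps.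

(** Induction: remove a set [W] containing a cograph [Q] and its neighbours in [Z], with
    [3 * M W <= mass z Q]. Then [Q] is anticomplete to what remains. Either a vertex serves as [Q],
    or [blob] at a vertex of maximum degree supplies it. *)
Lemma sparse_kappa (Z : {set T}) : Z \subset Y -> 3 * M Z <= k Z.
Proof.
have [n] := ubnP #|Z|; elim: n Z => // n IH Z leZ sZ.
have step (Q W : {set T}) : Q \subset Z -> cograph h Q -> Q \subset W -> W \subset Z -> Q != set0 ->
    (forall a b, a \in Q -> b \in Z :\: W -> ~~ h a b) -> 3 * M W <= mass z Q ->
    3 * M Z <= k Z.
  move=> sQ cQ QW WZ Q0 nQ le.
  have lt : (#|Z :\: W| < n)%N.
    rewrite ltnS in leZ; apply: leq_trans leZ; apply: proper_card; apply/properP; split; first exact: subsetDl.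
    have /set0Pn[q qQ] := Q0; exists q; first exact: subsetP sQ q qQ.
    by rewrite inE (subsetP QW q qQ).
  have := IH _ lt (subset_trans (subsetDl _ _) sZ); rewrite mass_diff // => le'.
  apply: (@le_trans _ _ (k Q + k (Z :\: W))).
    have := le_kappa z (subxx Q) cQ; move: le le'; lra.
  apply: kappa_pure => //; first exact: subsetDl.
    rewrite -setI_eq0; apply/eqP/setP => x; rewrite !inE.
    by case: (boolP (x \in Q)) => // /(subsetP QW) ->.
  by apply/pureP; right.
have sZV := subset_trans sZ sY.
pose nb x := [set u in Z | h x u].
case: (boolP [exists x in Z, 3 * (mu x + M (nb x)) <= z x]) => [/exists_inP[x xZ le]|].
  apply: (step [set x] (x |: nb x)); rewrite ?sub1set ?cograph1 //.
  - by rewrite inE set11.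
  - by rewrite subUset sub1set xZ; apply/subsetP => u /setIdP[].
  - by apply/set0Pn; exists x; rewrite set11.
  - by move=> a b /set1P-> /setDP[bZ]; rewrite !inE bZ negb_or => /andP[_].
  - by rewrite mass1; have := mass_setU mu_ge0 [set x] (nb x); rewrite mass1; move: le; lra.
rewrite negb_exists => /forallP big.
(* No vertex pays for its closed neighbourhood; with [8 * mu x <= z x] this gives even [24/5] in
   place of 6. *)
have {}big x : x \in Z -> z x < 6 * M (nb x).
  move=> xZ; have := big x; rewrite xZ /= -ltNge => lt.
  have := mu_atom (subsetP sZV x xZ); have := mass_ge0 mu_ge0 (nb x); move: lt; lra.
have [->|/set0Pn[x0 x0Z]] := eqVneq Z set0; first by rewrite mass0 mulr0 kappa_ge0.
pose v := [arg max_(x > x0 in Z) M (nb x)]%O.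
have [vZ maxv] : v \in Z /\ forall x, x \in Z -> M (nb x) <= M (nb v).
  by rewrite /v; case: arg_maxP.
set y := M (nb v) in maxv.
have y0 : 0 < y by have := big v vZ; have := z_ge0 v; rewrite -/y; lra.
have yeps : y <= eps.
  apply: le_trans (degY (subsetP sZ v vZ)); apply: mass_sub => //.
  by apply/subsetP => u; rewrite !inE => /andP[/(subsetP sZ) -> ->].
pose V' := Z :\: (v |: nb v).
have sN : nb v \subset V by apply: subset_trans sZV; apply/subsetP => u /setIdP[].
have sV' : V' \subset V by apply: subset_trans sZV; apply: subsetDl.
have hN x : x \in nb v -> h v x by case/setIdP.
have hV' c : c \in V' -> (v != c) && ~~ h v c.
  by move=> /setDP[cZ]; rewrite !inE cZ negb_or eq_sym.
have cl (U : {set T}) : U \subset nb v -> y ^+ 12 <= M U -> M (complete_to h V' U) <= y.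
  move=> sU MU; have : 0 < M U by apply: lt_le_trans MU; rewrite exprn_gt0.
  move=> /mass_gt0[u uU].
  have uZ : u \in Z by have /setIdP[] := subsetP sU u uU.
  apply: le_trans (maxv u uZ); apply: mass_sub => //; apply/subsetP => c.
  by rewrite !inE => /andP[/andP[_ ->] /forall_inP/(_ u uU)]; rewrite h_sym.
have L1 : 1 <= 6 :> R by lra.
have yL : 5184 * 6 ^+ 5 * y <= 1.
  by apply: le_trans eps_small; rewrite ler_wpM2l // mulr_ge0 // exprn_ge0.
have [Q [sQ cQ le]] := blob (subsetP sZV v vZ) sN sV' hN hV' y0 (lexx _) L1 yL cl.
have Q0 : Q != set0.
  apply: contraTneq le => ->; rewrite mass0 -ltNge mulr_gt0 //.
  by rewrite ltr_pwDl // mass_ge0.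
have sNZ : nb v \subset Z by apply/subsetP => u /setIdP[].
have sQZ := subset_trans sQ sNZ.
apply: (step Q ((v |: nb v) :|: touched h V' Q)) => //.
- by apply: subset_trans sQ _; rewrite -setUA setUCA subsetUl.
- rewrite !subUset sub1set vZ sNZ /=; apply/subsetP => c /setIdP[/setDP[]] //.
- move=> a b aQ /setDP[bZ]; rewrite in_setU negb_or => /andP[bN bt].
  apply: contra bt => hab; rewrite inE; apply/andP; split; first by rewrite inE bN.
  by apply/exists_inP; exists a => //; rewrite h_sym.
(* The removed mass is at most [mu v + y + M (touched h V' Q)] with [mu v <= 6 * y / 8], so [L = 6]
   pays for it three times. *)
- have := mass_setU mu_ge0 (v |: nb v) (touched h V' Q).
  have := mass_setU mu_ge0 [set v] (nb v); rewrite mass1 -/y.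
  have := mu_atom (subsetP sZV v vZ); have := big v vZ; rewrite -/y.
  have := mass_ge0 mu_ge0 (touched h V' Q); move: le; lra.
Qed.

Lemma sparse_absurd : 1 / 2 <= M Y -> False.
Proof.
have := sparse_kappa (subxx Y); have := kappa_sub h z sY; have := kV; lra.
Qed.
End Sparse.

(** * The dense case *)

Section Dense.
Variable eps : R.
Local Notation beta := ((1 / 2) ^+ m : R).
Local Notation far x := [set u in V | (x != u) && ~~ h x u].

Lemma beta_ge0 : 0 <= beta.
Proof. by rewrite exprn_ge0 //; lra. Qed.

(** Take a largest set [A] of mass at most [beta] that is complete to the rest of [S], and let [C]
    be a co-component outside [A]. By maximality [A :|: C] is heavier than [beta], so [pure_absurd]
    makes the remainder light. *)
Lemma giant (S : {set T}) : S \subset V -> beta < M S ->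
  exists C : {set T}, [/\ C \subset S, coconnected h C, M S - 2 * beta <= M C &
    forall a b, a \in C -> b \in S :\: C -> h a b].
Proof.
move=> sSV bS.
pose ok (A : {set T}) := [&& A \subset S, (M A <= beta)%R &
  [forall a in A, forall b in S :\: A, h a b]].
have ok0 : ok set0.
  by rewrite /ok sub0set mass0 beta_ge0; apply/forall_inP => a; rewrite inE.
case: (arg_maxnP (fun A : {set T} => #|A|) ok0) => A /and3P[sA MA clA'] maxA.
have clA a b : a \in A -> b \in S :\: A -> h a b.
  by move=> aA bS'; move/forall_inP/(_ a aA)/forall_inP/(_ b bS'): clA'.
have [s sSA] : exists s, s \in S :\: A.
  apply/set0Pn; rewrite setD_eq0; apply/negP => sSA.
  have := mass_sub mu_ge0 sSA; move: bS MA; lra.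
have /setDP[sS sNA] := sSA.
set C := [set x in S | connect (nonadj_in h S) s x].
have sC : C \subset S by apply/subsetP => x /setIdP[].
have dAC : [disjoint A & C].
  rewrite -setI_eq0; apply/set0Pn => -[x /setIP[xA /setIdP[_]]].
  rewrite (sym_connect_sym (nonadj_in_sym h_sym S)) => /(coconnect_closed clA xA).
  by rewrite (negPf sNA).
have clC := @component_closed _ h S s.
have sCs : s \in C by rewrite inE sS connect0.
have clAC a b : a \in A :|: C -> b \in S :\: (A :|: C) -> h a b.
  rewrite in_setU => aAC; rewrite in_setD in_setU negb_or => /andP[/andP[bA bC] bS'].
  case/orP: aAC => [aA|aC]; first by apply: clA; rewrite // inE bA.
  by apply: clC; rewrite // in_setD bC.
have sAC : A :|: C \subset S by rewrite subUset sA.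
have MAC : beta < M (A :|: C).
  rewrite ltNge; apply/negP => le.
  have : (#|A :|: C| <= #|A|)%N.
    apply: maxA; rewrite /ok sAC le /=; apply/forall_inP => a aAC.
    by apply/forall_inP => b; apply: clAC.
  rewrite leqNgt => /negP; apply; apply: proper_card; apply/properP; split; first exact: subsetUl.
  by exists s => //; rewrite inE sCs orbT.
have rest : M (S :\: (A :|: C)) <= beta.
  rewrite leNgt; apply/negP => lt.
  apply: (pure_absurd (subset_trans sAC sSV) (subset_trans (subsetDl S (A :|: C)) sSV) _ _ MAC lt).
    rewrite -setI_eq0; apply/eqP/setP => x; rewrite in_setI in_setD in_set0.
    by case: (x \in A :|: C).
  by apply/pureP; left.
exists C; split=> //; first exact: component_coconnected.
move: rest; rewrite mass_diff // massD //; move: MA; lra.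
Qed.

(* One step of a Gyarfas path in the complement: u' continues the path and C' is
   the part of C, out of reach of u, in which the path can go on. *)
Lemma path_step u (C : {set T}) : u \in V -> M (far u) <= eps -> C \subset V ->
    coconnected h (u |: C) -> eps + 4 * beta < M C ->
  exists u' (C' : {set T}), [/\ u' \in C, (u != u') && ~~ h u u', C' \subset C,
    coconnected h (u' |: C') & (forall x, x \in C' -> h u x) /\ M C - eps - 3 * beta <= M C'].
Proof.
move=> uV fu sC cC MC.
pose S := [set x in C | (x != u) && h u x].
have sSC : S \subset C by apply/subsetP => x /setIdP[].
have MS : M C - eps - beta <= M S.
  have sub : C \subset S :|: (u |: far u).
    apply/subsetP => x xC; rewrite !inE xC (subsetP sC x xC) /= (eq_sym u x).
    by case: (x == u); case: (h u x).
  have := mass_sub mu_ge0 sub; have := mass_setU mu_ge0 S (u |: far u).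
  have := mass_setU mu_ge0 [set u] (far u); rewrite mass1; have := mu_atom_half uV.
  move: fu; lra.
have b0 := beta_ge0.
have bS : beta < M S by move: MS MC; lra.
have [C' [sC' cC' MC' clC']] := giant (subset_trans sSC sC) bS.
have [w wC'] : exists w, w \in C' by apply: (@mass_gt0 _ _ mu); move: MC' MS MC; lra.
have uC' : u \notin C'.
  by apply/negP => /(subsetP sC')/setIdP[_]; rewrite eqxx.
(* The next vertex is non-adjacent both to [u] and to some vertex of [C']. Without one, [C'] would
   be complete to the rest of [u |: C], which is coconnected. *)
case: (boolP [exists u' in C, [&& u != u', ~~ h u u' & [exists a in C', ~~ h a u' && (u' \notin C')]]]).
  move=> /exists_inP[u' u'C /and3P[uu' nh /exists_inP[a aC' /andP[nha u'C']]]].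
  exists u', C'; split=> //; first by rewrite uu'.
  - exact: subset_trans sC' sSC.
  - apply: (coconnected_setU1 h_sym cC' aC'); last by rewrite h_sym.
    by apply: contraNneq u'C' => ->.
  - split; last by move: MC' MS; lra.
    by move=> x /(subsetP sC')/setIdP[_ /andP[]].
rewrite negb_exists => /forallP none; exfalso.
have cl a b : a \in C' -> b \in (u |: C) :\: C' -> h a b.
  move=> aC'; rewrite in_setD in_setU1 => /andP[bC' /orP[/eqP->|bC]].
    by rewrite h_sym; have /setIdP[_ /andP[]] := subsetP sC' a aC'.
  have [<-|ub] := eqVneq u b.
    by rewrite h_sym; have /setIdP[_ /andP[]] := subsetP sC' a aC'.
  case: (boolP (h u b)) => hub.
    by apply: clC' => //; rewrite in_setD bC' inE bC eq_sym ub.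
  have := none b; rewrite bC ub hub /= negb_exists => /forallP/(_ a).
  by rewrite aC' bC' andbT negbK.
have := cC w u; rewrite !in_setU1 eqxx (subsetP sSC _ (subsetP sC' w wC')) orbT => /(_ isT isT).
by move/(coconnect_closed cl wC'); rewrite (negPf uC').
Qed.

(** Four path steps start in a giant co-component of [D], and the mass left always permits the next
    one. Each new set is complete to the vertex just left, so the path [v1], ..., [v5] is induced in
    the complement. *)
Lemma dense_absurd (D : {set T}) : D \subset V -> (forall x, x \in D -> M (far x) <= eps) ->
  0 <= eps -> eps <= 1 / 100 -> beta <= 1 / 1000 -> 1 / 2 <= M D -> False.
Proof.
move=> sD fD e0 e1 b1 MD; have b0 := beta_ge0.
have bD : beta < M D by lra.
have [C1 [sC1 cC1 M1 _]] := giant sD bD.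
have [v1 v1C] : exists v, v \in C1 by apply: (@mass_gt0 _ _ mu); lra.
have inD (C : {set T}) : C \subset C1 -> C \subset D by move=> sC; apply: subset_trans sC1.
have inV (C : {set T}) : C \subset C1 -> C \subset V by move=> sC; apply: subset_trans (inD _ sC) sD.
have vV v : v \in C1 -> v \in V by apply: (subsetP (inV _ (subxx _))).
have fv v : v \in C1 -> M (far v) <= eps by move=> vC; apply: fD; apply: (subsetP sC1).
have c1 : coconnected h (v1 |: C1) by rewrite (setUidPr _) // sub1set.
have [|v2 [C2 [v2C a12 s2 c2 [h1 M2]]]] := path_step (vV _ v1C) (fv _ v1C) (inV _ (subxx _)) c1; first lra.
have [|v3 [C3 [v3C a23 s3 c3 [h2 M3]]]] := path_step (vV _ v2C) (fv _ v2C) (inV _ s2) c2; first lra.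
have s31 := subset_trans s3 s2; have v3C1 := subsetP s2 _ v3C.
have [|v4 [C4 [v4C a34 s4 c4 [h3 M4]]]] := path_step (vV _ v3C1) (fv _ v3C1) (inV _ s31) c3; first lra.
have s41 := subset_trans s4 s31; have v4C1 := subsetP s31 _ v4C.
have [|v5 [C5 [v5C a45 _ _ _]]] := path_step (vV _ v4C1) (fv _ v4C1) (inV _ s41) c4; first lra.
have /andP[n12 e12] := a12; have /andP[n23 e23] := a23.
have /andP[n34 e34] := a34; have /andP[n45 e45] := a45.
have v4C2 := subsetP s3 _ v4C; have v5C3 := subsetP s4 _ v5C; have v5C2 := subsetP s3 _ v5C3.
apply: (hf (h1 _ v3C) (h1 _ v4C2) (h1 _ v5C2) (h2 _ v4C) (h2 _ v5C3) (h3 _ v5C)) => //.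
Qed.
End Dense.

(** Otherwise [blob] with [L = 2 / eps] gives [Q] in [N] touching at most [eps / 2], as
    [mass z Q <= 1]. The untouched rest [W] has mass at least [eps / 2] and is anticomplete to [Q],
    so [k W <= 1 - 2 / eps * y], against [ym]. *)
Lemma degree_dichotomy (eps y : R) v :
    v \in V -> 0 < eps -> 0 < y -> y <= eps -> eps <= 1 -> 5184 * (2 / eps) ^+ 5 * y <= 1 ->
    (1 / 2) ^+ m < y ^+ 12 -> (1 - 2 / eps * y) ^+ m < eps / 2 ->
  M [set u in V | h v u] <= eps \/ M [set u in V | (v != u) && ~~ h v u] <= eps.
Proof.
move=> vV e0 y0 ye e1 yL yb ym; pose N := [set u in V | h v u].
pose V' := [set u in V | (v != u) && ~~ h v u].
have [?|eN] := lerP (M N) eps; first by left.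
have [?|eV'] := lerP (M V') eps; [by right|exfalso].
have sN : N \subset V by apply/subsetP => u /setIdP[].
have sV' : V' \subset V by apply/subsetP => u /setIdP[].
have hN x : x \in N -> h v x by case/setIdP.
have hV' c : c \in V' -> (v != c) && ~~ h v c by case/setIdP.
have L1 : 1 <= 2 / eps by rewrite ler_pdivlMr // mul1r; lra.
have dNV' : [disjoint N & V'].
  rewrite -setI_eq0; apply/eqP/setP => x; rewrite !inE.
  by case: (h v x); rewrite ?andbF.
have y1 : y ^+ 12 <= y by rewrite -[leRHS]expr1; apply: ler_wiXn2l => //; lra.
have cl (U : {set T}) : U \subset N -> y ^+ 12 <= M U -> M (complete_to h V' U) <= y.
  move=> sU MU; rewrite leNgt; apply/negP => lt.
  have sc : complete_to h V' U \subset V' by apply/subsetP => c /setIdP[].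
  apply: (@pure_absurd U (complete_to h V' U)).
  - exact: subset_trans sU sN.
  - exact: subset_trans sc sV'.
  - exact: disjointWl sU (disjointWr sc dNV').
  - apply/pureP; left => a c aU /setIdP[_ /forall_inP/(_ a aU)].
    by rewrite h_sym.
  - exact: lt_le_trans yb MU.
  - by apply: lt_trans lt; apply: lt_le_trans yb _.
have yN : y <= M N by apply: ltW; apply: le_lt_trans eN.
have [Q [sQ cQ le]] := blob vV sN sV' hN hV' y0 yN L1 yL cl.
have zQ1 : mass z Q <= 1 by apply: le_trans kV; apply: le_kappa => //; apply: subset_trans sN.
pose W := V' :\: touched h V' Q.
have sW : W \subset V' := subsetDl _ _.
have st : touched h V' Q \subset V' by apply/subsetP => c /setIdP[].
have tQ : 2 * M (touched h V' Q) <= eps.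
  have : 2 / eps * M (touched h V' Q) <= 1.
    apply: le_trans zQ1; apply: le_trans le; rewrite ler_wpM2l ?lerDr ?ltW //.
    by apply: lt_le_trans L1.
  by rewrite mulrAC ler_pdivrMr // mul1r.
have MW : eps / 2 <= M W by rewrite mass_diff //; lra.
have kQW : k Q + k W <= k V.
  apply: kappa_pure; [exact: subset_trans sN|exact: subset_trans sV'| |].
    exact: disjointWl sQ (disjointWr sW dNV').
  apply/pureP; right => a b aQ /setDP[bV' bt]; apply: contra bt => hab.
  by rewrite inE bV'; apply/exists_inP; exists a => //; rewrite h_sym.
have zQ : mass z Q <= k Q by apply: le_kappa.
have kW : k W <= 1 - 2 / eps * y.
  have : 2 / eps * y <= mass z Q.
    apply: le_trans le; rewrite ler_wpM2l ?lerDl ?mass_ge0 //.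
    by apply: le_trans L1.
  have := kV; lra.
have := le_trans MW (mu_le (subset_trans sW sV')); apply/negP; rewrite -ltNge.
apply: le_lt_trans ym; apply: lerXn2r => //; rewrite nnegrE ?kappa_ge0 //.
by apply: le_trans kW; apply: kappa_ge0.
Qed.

Lemma counterexample_absurd (eps y : R) :
    0 < eps -> 0 < y -> y <= eps -> 5184 * 6 ^+ 5 * eps <= 1 ->
    5184 * (2 / eps) ^+ 5 * y <= 1 -> (1 / 2) ^+ m <= 1 / 1000 :> R ->
    (1 / 2) ^+ m < y ^+ 12 -> (1 - 2 / eps * y) ^+ m < eps / 2 -> False.
Proof.
move=> e0 y0 ye e6 yL b1 yb ym.
have e100 : eps <= 1 / 100 by move: e6; lra.
have e1 : eps <= 1 by lra.
pose Y := [set x in V | M [set u in V | h x u] <= eps].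
have sY : Y \subset V by apply/subsetP => x /setIdP[].
have [MY|MY] := lerP (1 / 2) (M Y).
  apply: (sparse_absurd sY e6 _ MY) => x /setIdP[_].
  apply: le_trans; apply: mass_sub => //; apply/subsetP => u /setIdP[uY hu].
  by rewrite inE (subsetP sY _ uY).
apply: (@dense_absurd eps (V :\: Y) (subsetDl _ _) _ (ltW e0) e100 b1).
  move=> x /setDP[xV]; rewrite inE xV /= => nY.
  by have [le|//] := degree_dichotomy xV e0 y0 ye e1 yL yb ym; rewrite le in nY.
by rewrite mass_diff // muV; lra.
Qed.
End Counterexample.

(** * The weighted theorem by induction on the vertex set *)

Section Weighted.
Variables (T : finType) (h : rel T).
Hypotheses (h_sym : symmetric h) (h_irr : irreflexive h) (hf : house_free h).
Variables (R : realFieldType) (m : nat) (eps y : R).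
Hypotheses (m_ge : (34 <= m)%N) (e0 : 0 < eps) (y0 : 0 < y) (ye : y <= eps).
Hypotheses (e6 : 5184 * 6 ^+ 5 * eps <= 1) (yL : 5184 * (2 / eps) ^+ 5 * y <= 1).
Hypotheses (b1 : (1 / 2) ^+ m <= 1 / 1000 :> R) (yb : (1 / 2) ^+ m < y ^+ 12).
Hypothesis ym : (1 - 2 / eps * y) ^+ m < eps / 2.

Lemma weighted_cograph (V : {set T}) (z : T -> R) : (forall x, 0 <= z x) ->
  exists P : {set T}, [/\ P \subset V, cograph h P & \sum_(x in V) z x ^+ m <= mass z P ^+ m].
Proof.
have [n] := ubnP #|V|; elim: n V z => // n IH V z leV z0.
set w := \sum_(x in V) z x ^+ m.
have [le|lt] := lerP w (kappa h z V ^+ m).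
  by exists (best h z V); rewrite best_sub best_cograph.
exfalso; set c := kappa h z V in lt.
have zc x : x \in V -> z x <= c.
  by move=> xV; rewrite -(mass1 z); apply: le_kappa; rewrite ?sub1set ?cograph1.
have c0 : 0 < c.
  rewrite lt_neqAle kappa_ge0 // andbT; apply/eqP => c0.
  have m0 : m != 0 by case: (m) m_ge.
  move: lt; rewrite -c0 expr0n (negPf m0) /w big1 ?ltxx // => x xV.
  have -> : z x = 0 by apply/eqP; rewrite eq_le z0 c0 zc.
  by rewrite expr0n (negPf m0).
have w0 : 0 < w by apply: le_lt_trans lt; rewrite exprn_ge0 // ltW.
have cm0 : 0 < c ^+ m by rewrite exprn_gt0.
pose z1 x := z x / c; pose mu x := z x ^+ m / w.
have z1_ge0 x : 0 <= z1 x by rewrite divr_ge0 // ltW.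
have mu_ge0 x : 0 <= mu x by rewrite divr_ge0 ?exprn_ge0 // ltW.
have mz1 (P : {set T}) : mass z1 P = mass z P / c by rewrite /mass -mulr_suml.
have mmu (P : {set T}) : mass mu P = (\sum_(x in P) z x ^+ m) / w by rewrite /mass -mulr_suml.
have IHp (S : {set T}) (z' : T -> R) : S \proper V -> (forall x, 0 <= z' x) ->
    exists P : {set T}, [/\ P \subset S, cograph h P & \sum_(x in S) z' x ^+ m <= mass z' P ^+ m].
  move=> prS z'0; apply: IH => //; rewrite ltnS in leV.
  exact: leq_trans (proper_card prS) leV.
have kz1 : 1 <= kappa h z1 V.
  have := le_kappa z1 (best_sub h z V) (best_cograph h z V).
  by rewrite mz1 -/(kappa h z V) -/c divff // gt_eqF.
apply: (counterexample_absurd h_sym h_irr hf z1_ge0 mu_ge0 _ _ _ _ IHp m_ge e0 y0 ye e6 yL b1 yb ym).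
- by rewrite /kappa mz1 ler_pdivrMr // mul1r; apply: le_kappa; rewrite ?best_sub ?best_cograph.
- by rewrite mmu divff // gt_eqF.
- move=> x xV; rewrite ltr_pdivrMr // mul1r; apply: le_lt_trans lt.
  by apply: lerXn2r; rewrite ?nnegrE ?zc // ltW.
(* For [U = V] both sides are compared with 1; for proper [U] induction gives a cograph of weight at
   most [kappa h z1 U * c], and [c ^+ m < w]. *)
- move=> U sU; have [->|UV] := eqVneq U V.
    by rewrite mmu divff ?gt_eqF // exprn_ege1.
  have prU : U \proper V by rewrite properEneq UV.
  have [P [sP cP le]] := IHp U z prU z0.
  rewrite mmu ler_pdivrMr //; apply: le_trans le _.
  have := le_kappa z1 sP cP; rewrite mz1 ler_pdivrMr // => le.
  apply: (@le_trans _ _ ((kappa h z1 U * c) ^+ m)).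
    by apply: lerXn2r; rewrite ?nnegrE ?mass_ge0 ?mulr_ge0 ?kappa_ge0 // ltW.
  by rewrite exprMn ler_wpM2l ?exprn_ge0 ?kappa_ge0 // ltW.
Qed.
End Weighted.

(** * Cliques and stable sets in cographs *)

Section Ramsey.
Variables (T : finType) (h : rel T).
Hypothesis h_sym : symmetric h.

(** Induction along a pure split: on a complete pair cliques add up and the larger stable set is
    kept, and [a * b + c * d <= (a + c) * maxn b d]. The anticomplete case is dual. *)
Lemma cograph_clique_stable (P : {set T}) : cograph h P -> exists C S : {set T},
  [/\ (C \subset P) && (S \subset P), forall x y, x \in C -> y \in C -> x != y -> h x y,
   forall x y, x \in S -> y \in S -> x != y -> ~~ h x y & (#|P| <= #|C| * #|S|)%N].
Proof.
have [n] := ubnP #|P|; elim: n P => // n IH P leP cP.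
have [cP1|cP1] := leqP #|P| 1.
  exists P, P; rewrite subxx; split=> //.
  - by move=> x y xP yP; rewrite (card_le1_eqP cP1 x y xP yP) eqxx.
  - by move=> x y xP yP; rewrite (card_le1_eqP cP1 x y xP yP) eqxx.
  - by case: (#|P|) cP1 => [|[]].
have [B [sB B0 BP pB]] := cographP _ _ cP P (subxx _) cP1.
have sB' : P :\: B \subset P := subsetDl _ _.
have ltB : (#|B| < #|P|)%N by apply: proper_card; rewrite properEneq BP.
have ltB' : (#|P :\: B| < #|P|)%N.
  have [b bB] := set0Pn _ B0; apply: proper_card; apply/properP; split=> //.
  by exists b; rewrite ?inE ?bB // (subsetP sB).
have [C1 [S1 [/andP[sC1 sS1] cl1 st1 le1]]] := IH B (leq_trans ltB leP) (cograph_sub sB cP).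
have [C2 [S2 [/andP[sC2 sS2] cl2 st2 le2]]] := IH _ (leq_trans ltB' leP) (cograph_sub sB' cP).
have cardP : #|P| = (#|B| + #|P :\: B|)%N by rewrite -(cardsID B P) (setIidPr sB).
have dB : [disjoint B & P :\: B].
  rewrite -setI_eq0; apply/eqP/setP => x; rewrite !inE.
  by case: (x \in B).
have union (b : bool) (A1 A2 : {set T}) : A1 \subset B -> A2 \subset P :\: B ->
    (forall x y, x \in B -> y \in P :\: B -> h x y = b) ->
    (forall x y, x \in A1 -> y \in A1 -> x != y -> h x y = b) ->
    (forall x y, x \in A2 -> y \in A2 -> x != y -> h x y = b) ->
    (forall x y, x \in A1 :|: A2 -> y \in A1 :|: A2 -> x != y -> h x y = b) /\
    #|A1 :|: A2| = (#|A1| + #|A2|)%N.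
  move=> /subsetP s1 /subsetP s2 hB h1 h2; split.
    move=> x y; rewrite !inE => /orP[xA|xA] /orP[yA|yA] xy.
    - exact: h1.
    - by apply: hB; [apply: s1|apply: s2].
    - by rewrite h_sym; apply: hB; [apply: s1|apply: s2].
    - exact: h2.
  have dA : [disjoint A1 & A2] by apply: disjointWl (disjointWr _ dB); apply/subsetP.
  by rewrite cardsU (disjoint_setI0 dA) cards0 subn0.
have subU (A1 A2 : {set T}) : A1 \subset B -> A2 \subset P :\: B -> A1 :|: A2 \subset P.
  by move=> s1 s2; rewrite subUset (subset_trans s1 sB) (subset_trans s2 sB').
have max (a b c d : nat) : (#|B| <= a * b)%N -> (#|P :\: B| <= c * d)%N ->
    (#|P| <= (a + c) * maxn b d)%N.
  move=> h1 h2; rewrite cardP mulnDl leq_add //.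
    by apply: leq_trans h1 _; rewrite leq_mul2l leq_maxl orbT.
  by apply: leq_trans h2 _; rewrite leq_mul2l leq_maxr orbT.
have neg (b1 : bool) : ~~ b1 -> b1 = false by apply: negbTE.
case/pureP: pB => hB.
  have [clU cardU] := union true C1 C2 sC1 sC2 hB cl1 cl2.
  have le := max _ _ _ _ le1 le2; rewrite -cardU in le.
  have [le12|lt12] := leqP #|S1| #|S2|.
    exists (C1 :|: C2), S2; split=> //; first by rewrite subU // (subset_trans sS2).
    by move: le; rewrite (maxn_idPr le12).
  exists (C1 :|: C2), S1; split=> //; first by rewrite subU // (subset_trans sS1).
  by move: le; rewrite (maxn_idPl (ltnW lt12)).
have [stU cardU] : (forall x y, x \in S1 :|: S2 -> y \in S1 :|: S2 -> x != y -> h x y = false) /\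
    #|S1 :|: S2| = (#|S1| + #|S2|)%N.
  apply: union => // x y *; apply: negbTE; [exact: hB|exact: st1|exact: st2].
have stU' x y : x \in S1 :|: S2 -> y \in S1 :|: S2 -> x != y -> ~~ h x y.
  by move=> xS yS xy; rewrite stU.
rewrite mulnC in le1; rewrite mulnC in le2.
have le := max _ _ _ _ le1 le2; rewrite -cardU mulnC in le.
have [le12|lt12] := leqP #|C1| #|C2|.
  exists C2, (S1 :|: S2); split=> //; first by rewrite subU // (subset_trans sC2).
  by move: le; rewrite (maxn_idPr le12).
exists C1, (S1 :|: S2); split=> //; first by rewrite subU // (subset_trans sC1).
by move: le; rewrite (maxn_idPl (ltnW lt12)).
Qed.
End Ramsey.

(** * Choice of the constants *)

Section Constants.
Variable R : archiRealFieldType.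

Lemma pow_small (s d : R) : 0 < s -> s <= 1 -> 0 < d ->
  exists n0, forall n, (n0 <= n)%N -> (1 - s) ^+ n < d.
Proof.
move=> s0 s1 d0.
have bern n : (1 - s) ^+ n * (1 + n%:R * s) <= 1.
  elim: n => [|n IH]; first by rewrite expr0 mul0r addr0 mulr1.
  apply: le_trans IH; rewrite exprSr -mulrA ler_wpM2l ?exprn_ge0 ?subr_ge0 //.
  have : 0 <= n.+1%:R * (s * s) :> R by rewrite mulr_ge0 // mulr_ge0 // ltW.
  rewrite -natr1; lra.
exists (Num.bound (1 / (s * d))) => n le.
have sd : 0 < s * d by rewrite mulr_gt0.
have nb : 1 / (s * d) < n%:R.
  apply: lt_le_trans (archi_boundP _) _; first by rewrite divr_ge0 // ltW.
  by rewrite ler_nat.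
rewrite ltr_pdivrMr // in nb.
have ns : 1 < (1 + n%:R * s) * d by lra.
have p : 0 < 1 + n%:R * s by rewrite ltr_pwDl // mulr_ge0 // ltW.
rewrite -(ltr_pM2r p) mulrC (mulrC d); apply: le_lt_trans ns; rewrite mulrC; exact: bern.
Qed.

(** First [eps] is fixed, then [y] in terms of [eps]; the other conditions hold once [m] is
    large. *)
Lemma constants : exists (eps y : R) (m : nat),
  [/\ (34 <= m)%N, 0 < eps, 0 < y & y <= eps] /\
  [/\ 5184 * 6 ^+ 5 * eps <= 1, 5184 * (2 / eps) ^+ 5 * y <= 1,
      (1 / 2) ^+ m <= 1 / 1000 :> R, (1 / 2) ^+ m < y ^+ 12 &
      (1 - 2 / eps * y) ^+ m < eps / 2].
Proof.
have [eps [e0 e6]] : exists eps : R, 0 < eps /\ 5184 * 6 ^+ 5 * eps <= 1.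
  have c0 : 0 < 5184 * 6 ^+ 5 :> R by rewrite mulr_gt0 // exprn_gt0.
  by exists (5184 * 6 ^+ 5)^-1; rewrite invr_gt0 c0 divff // gt_eqF.
have e1 : eps <= 1 by lra.
have q1 : 1 <= 2 / eps by rewrite ler_pdivlMr // mul1r; lra.
have [y [y0 ye yL sy]] : exists y : R,
    [/\ 0 < y, y <= eps, 5184 * (2 / eps) ^+ 5 * y <= 1 & 2 / eps * y <= 1].
  set c := 5184 * (2 / eps) ^+ 5.
  have q5 : 1 <= (2 / eps) ^+ 5 by rewrite exprn_ege1.
  have c1 : 1 <= c by rewrite /c; lra.
  have c0 : 0 < c by lra.
  exists (eps / c); split.
  - by rewrite divr_gt0.
  - by rewrite ler_pdivrMr // ler_peMr // ltW.
  - by rewrite mulrCA divff ?mulr1 // gt_eqF.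
  - rewrite mulrA divfK ?gt_eqF // ler_pdivrMr // mul1r /c; lra.
have y12 : 0 < y ^+ 12 by rewrite exprn_gt0.
have s0 : 0 < 2 / eps * y by rewrite mulr_gt0 // divr_gt0.
have half0 : 0 < 1 / 2 :> R by lra.
have half1 : 1 / 2 <= 1 :> R by lra.
have d0 : 0 < 1 / 1000 :> R by lra.
have [n1 H1] := pow_small half0 half1 d0.
have [n2 H2] := pow_small half0 half1 y12.
have e2 : 0 < eps / 2 by rewrite divr_gt0.
have [n3 H3] := pow_small s0 sy e2.
exists eps, y, (34 + n1 + n2 + n3)%N; split; first by split=> //; rewrite -!addnA leq_addr.
have half : 1 - 1 / 2 = 1 / 2 :> R by lra.
rewrite half in H1 H2; split=> //.
- by apply/ltW/H1; rewrite -addnA -addnA addnCA leq_addr.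
- by apply: H2; rewrite -addnA addnCA leq_addr.
- by apply: H3; rewrite leq_addl.
Qed.
End Constants.

(** * From cographs to cliques and stable sets *)

Section Complement.
Variables (T : finType) (e : rel T).
Hypothesis e_simple : simple_graph e.

Definition co_rel : rel T := [rel x y | (x != y) && ~~ e x y].

Lemma co_rel_sym : symmetric co_rel.
Proof. by move=> x y; rewrite /co_rel /= eq_sym; have [-> _] := e_simple. Qed.

Lemma co_rel_irr : irreflexive co_rel.
Proof. by move=> x; rewrite /co_rel /= eqxx. Qed.

Lemma co_relN x y : x != y -> ~~ co_rel x y -> e x y.
Proof. by rewrite /co_rel /= => ->; rewrite negbK. Qed.

Lemma P5_free_house_free : P5_free e -> house_free co_rel.
Proof.
move=> nP5 v c x b a hvx hvb hva hcb hca hxa vc nvc cx ncx xb nxb ba nba; apply: nP5.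
have [e_sym e_irr] := e_simple.
have [[e1 e2] [e3 e4]] := ((co_relN vc nvc, co_relN cx ncx), (co_relN xb nxb, co_relN ba nba)).
move: hvx hvb hva hcb hca hxa; rewrite /co_rel /=.
move=> /andP[d1 /negbTE f1] /andP[d2 /negbTE f2] /andP[d3 /negbTE f3].
move=> /andP[d4 /negbTE f4] /andP[d5 /negbTE f5] /andP[d6 /negbTE f6].
pose s := [:: v; c; x; b; a].
have us : uniq s by rewrite /= !inE !negb_or vc d1 d2 d3 cx d4 d5 xb d6 ba.
exists (fun i : 'I_5 => nth v s i); split.
  by move=> i j /eqP; rewrite nth_uniq // => /eqP/val_inj.
move=> [i li] [j lj] /=.
by case: i li => [|[|[|[|[|i]]]]] li //; case: j lj => [|[|[|[|[|j]]]]] lj //=;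
  rewrite ?e_irr ?e1 ?e2 ?e3 ?e4 ?f1 ?f2 ?f3 ?f4 ?f5 ?f6 // e_sym
    ?e1 ?e2 ?e3 ?e4 ?f1 ?f2 ?f3 ?f4 ?f5 ?f6.
Qed.
End Complement.

(** With unit weights the weighted theorem reads [#|T| <= #|P| ^ m]; as [#|P| <= #|C| * #|S|], the
    larger of [C] and [S] works with exponent [m * 2]. *)
Lemma P5_free_polynomial (K : archiRealFieldType) : exists2 d : nat, (0 < d)%N &
  forall (T : finType) (e : rel T), simple_graph e -> P5_free e ->
    exists S : {set T}, (is_clique e S \/ is_stable e S) /\ (#|T| <= #|S| ^ d)%N.
Proof.
have [eps [y [m [[m34 e0 y0 ye] [e6 yL b1 yb ym]]]]] := constants K.
exists (m * 2)%N; first by rewrite muln_gt0 (leq_trans _ m34).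
move=> T e se nP5; pose h := co_rel e.
have hs := co_rel_sym se.
have [P [_ cP]] := weighted_cograph hs (co_rel_irr e) (P5_free_house_free se nP5)
  m34 e0 y0 ye e6 yL b1 yb ym [set: T] (fun _ => @ler01 K).
rewrite /mass !sumr_const expr1n cardsT -natrX ler_nat => TP.
have [C [S [_ clC stS PCS]]] := cograph_clique_stable hs cP.
have stC : is_stable e C.
  by move=> x w xC wC xw; have := clC x w xC wC xw; rewrite /co_rel /= => /andP[].
have clS : is_clique e S.
  by move=> x w xS wS xw; apply: co_relN => //; apply: stS.
have bound n : (#|C| <= n)%N -> (#|S| <= n)%N -> (#|T| <= n ^ (m * 2))%N.
  move=> Cn Sn; apply: leq_trans TP _; rewrite mulnC expnM leq_exp2r ?(leq_trans _ m34) //.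
  by apply: leq_trans PCS _; rewrite -mulnn leq_mul.
have [CS|SC] := leqP #|C| #|S|.
  by exists S; split; [left|apply: bound].
by exists C; split; [right|apply: bound => //; apply: ltnW].
Qed.

(* Passage to a real exponent *)
Local Close Scope ring_scope.
From Stdlib Require Import Reals.

Theorem theorem1p2 :
  exists c : R, (0 < c)%R /\
    forall (T : finType) (e : rel T),
      (1 <= #|T|)%N -> simple_graph e -> P5_free e ->
      exists S : {set T}, (is_clique e S \/ is_stable e S) /\
        (Rpower (INR #|T|) c <= INR #|S|)%R.
Proof.
(* All estimates can be made over the rationals; only the integer [d] passes to the reals, with
   [c = 1 / d]. *)
have [d d0 H] := P5_free_polynomial rat.
have dR : Rlt 0 (INR d) by apply: lt_0_INR; apply/ssrnat.ltP.
exists (Rinv (INR d)); split; first exact: Rinv_0_lt_compat.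
move=> T e T0 se nP5; have [S [clst TS]] := H T e se nP5.
exists S; split=> //.
have S0 : (0 < #|S|)%N.
  by rewrite lt0n; apply: contraTneq TS => ->; rewrite exp0n // -ltnNge.
have SR : Rlt 0 (INR #|S|) by apply: lt_0_INR; apply/ssrnat.ltP.
have TR : Rlt 0 (INR #|T|) by apply: lt_0_INR; apply/ssrnat.ltP.
have INR_expn n k : INR (expn n k) = pow (INR n) k.
  by elim: k => [|k IH] //; rewrite expnS -multE mult_INR IH.
have le : Rle (INR #|T|) (Rpower (INR #|S|) (INR d)).
  by rewrite Rpower_pow // -INR_expn; apply: le_INR; apply/ssrnat.leP.
apply: Rle_trans (Rle_Rpower_l _ _ _ _ (conj TR le)) _.
  by left; apply: Rinv_0_lt_compat.
rewrite Rpower_mult Rinv_r ?Rpower_1 //; first exact: Rle_refl.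
exact: Rgt_not_eq.
Qed.
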